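(* Let $G$ be a connected graph of order $n$ with stability number $\alpha$ (so $1\le\alpha\le n-1$ when $n\ge 2$). Then $F(G)\le f_{\sf TC}(n,\alpha)$, with equality if and only if $G\simeq TC_{n,\alpha}$ when $(n,\alpha)\neq(5,2)$, and if and only if $G\simeq TC_{5,2}$ or $G\simeq C_5$ (the cycle on $5$ vertices) when $(n,\alpha)=(5,2)$.
   Context: All graphs are finite, simple and undirected. The Fibonacci index $F(G)$ is the number of stable sets of $G$, including the empty set; $\alpha(G)$ is the stability number. For $1\le\alpha\le n$, the Turán graph $T_{n,\alpha}$ is the disjoint union of $\alpha$ cliques whose orders sum to $n$ and differ pairwise by at most one. For $1\le\alpha\le n-1$, the Turán-connected graph $TC_{n,\alpha}$ is obtained from $T_{n,\alpha}$ by choosing a vertex $v$ in a clique of size $\lceil n/\alpha\rceil$ and adding $\alpha-1$ edges joining $v$ to one vertex of each of the other $\alpha-1$ cliques. $f_{\sf TC}(n,\alpha)$ denotes $F(TC_{n,\alpha})$. *)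

(* Defs.v *)
From mathcomp Require Import all_boot.
Set Implicit Arguments.
Unset Strict Implicit.
Unset Printing Implicit Defensive.

Record sgraph := SGraph {
  vertex :> finType;
  adj : rel vertex;
  adj_sym : symmetric adj;
  adj_irrefl : irreflexive adj
}.

Section Invariants.
Variable G : sgraph.

Definition connected : Prop :=
  0 < #|G| /\ forall x y : G, connect (@adj G) x y.

Definition stable (S : {set G}) : bool :=
  [forall x in S, forall y in S, ~~ adj x y].

Definition stability_number : nat := \max_(S : {set G} | stable S) #|S|.

Definition fibonacci_index : nat := #|[set S : {set G} | stable S]|.

End Invariants.

Definition isomorphic (G H : sgraph) : Prop :=
  exists2 f : G -> H, bijective f & forall x y, adj (f x) (f y) = adj x y.

Section OrdinalGraph.
Variables (n : nat) (r : rel 'I_n).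

Let e : rel 'I_n := fun i j => (i != j) && (r i j || r j i).

Fact ord_graph_sym : symmetric e.
Proof. by move=> i j; rewrite /e eq_sym orbC. Qed.

Fact ord_graph_irrefl : irreflexive e.
Proof. by move=> i; rewrite /e eqxx. Qed.

(* The loopless symmetric closure of r. *)
Definition ord_graph : sgraph := SGraph ord_graph_sym ord_graph_irrefl.

End OrdinalGraph.

(* The cliques of T_{n,a} are the residue classes mod a in {0, ..., n-1}. For
   1 <= a <= n and c < a, the class of c has n %/ a + (c < n %% a) elements:
   there are a nonempty cliques, their orders differ by at most one, and the
   class of 0 has the largest order, ceil(n / a). *)
Definition turan (n a : nat) : sgraph :=
  ord_graph (fun i j : 'I_n => i == j %[mod a]).

(* The distinguished vertex v is 0; the representatives 1, ..., a-1 of the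
   other a-1 classes are its additional neighbours. By the symmetry of cliques
   other choices of v and of the representatives give isomorphic graphs. *)
Definition turan_connected (n a : nat) : sgraph :=
  ord_graph (fun i j : 'I_n =>
    @adj (turan n a) i j || [&& i == 0 :> nat, 0 < j & j < a]).

Definition f_TC (n a : nat) : nat := fibonacci_index (turan_connected n a).

(* The cycle on n vertices, for n >= 3. *)
Definition cycle_graph (n : nat) : sgraph :=
  ord_graph (fun i j : 'I_n => j == i.+1 %% n :> nat).

(* Main.v *)
Require Import Defs.
From mathcomp Require Import all_boot.
From mathcomp Require Import zify ring.
Set Implicit Arguments.
Unset Strict Implicit.
Unset Printing Implicit Defensive.

(** Let F count stable sets. For every vertex v, F(G) = F(G - v) + F(G - N[v]).
    With v of maximum degree this yields by induction Turan's bound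
    F(G) <= F(T_{n,a}), with equality only for disjoint unions of cliques.

    For connected G, induct on the number of vertices and edges.
    - If deleting some edge keeps both the stability number and connectedness,
      it strictly increases F.
    - If deleting xy keeps the stability number and splits G into U and W, then
      F(G) is a polynomial in the counts for U, U - x, U - N[x] and W, W - y,
      W - N[y]; induction and Turan's bound for these bound it by the count for
      two Turan-connected graphs with joined hubs, and moving all the spokes of
      one hub to the other does not decrease this count.
    - Otherwise every edge is critical. Critical edges at a cut vertex cannot
      lead to two different sides, so there is no cut vertex. A vertex v of
      maximum degree d satisfies n - 1 <= a d by a greedy construction of a
      stable set, and the bound follows from induction for G - v and Turan's
      bound for G - N[v]. For a >= 2, equality forces n - 1 = a d and G - v to
      be Turan-connected; since its hub has degree at most d, G is C_5. *)

(** * Numbers of stable sets of Turan and Turan-connected graphs *)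

(* F(T_{n,a}). For [a = 0] this is the junk value [2 ^ n], which keeps it
   strictly increasing in [n] for every [a]. *)
Definition turan_num n a := (n %/ a).+1 ^ (a - n %% a) * (n %/ a).+2 ^ (n %% a).
(* For [m = n - 1], the number of stable sets of TC_{n,a} containing the hub: they
   avoid its clique and one vertex of every other clique. *)
Definition spoke_num m a := turan_num (m - m %/ a - a.-1) a.-1.
Definition tc_num n a := turan_num n.-1 a + spoke_num n.-1 a.

Lemma turan_num0r n : turan_num n 0 = 2 ^ n.
Proof. by rewrite /turan_num divn0 modn0 sub0n mul1n. Qed.

Lemma turan_num0l a : turan_num 0 a = 1.
Proof. by rewrite /turan_num div0n mod0n exp1n. Qed.

Lemma turan_num1r n : turan_num n 1 = n.+1.
Proof. by rewrite /turan_num divn1 modn1 subn0 expn1 muln1. Qed.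

(* Also valid for [r = a], where quotient and remainder change. *)
Lemma turan_numE q r a : 0 < a -> r <= a ->
  turan_num (q * a + r) a = q.+1 ^ (a - r) * q.+2 ^ r.
Proof.
move=> a0; rewrite leq_eqVlt => /orP[/eqP->|ra].
  by rewrite /turan_num -mulSnr mulnK // modnMl !subn0 subnn !expn0 muln1 mul1n.
by rewrite /turan_num divnMDl // modnMDl (divn_small ra) (modn_small ra) addn0.
Qed.

(** Deleting a vertex of a largest clique of T_{m+1,a} leaves T_{m,a}; deleting that whole clique,
    of order [m %/ a + 1], leaves a Turan graph with [a - 1] cliques. *)
Lemma turan_numS m a : 0 < a ->
  turan_num m.+1 a = turan_num m a + turan_num (m - m %/ a) a.-1.
Proof.
case: a => // b _ /=; set a := b.+1.
set q := m %/ a; set r := m %% a.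
have ra : r < a by rewrite ltn_mod.
have Em : m = q * a + r by rewrite -divn_eq.
have -> : m.+1 = q * a + r.+1 by lia.
have -> : m - q = q * b + r by rewrite {1}Em /a mulnS; lia.
rewrite Em (@turan_numE q r.+1 a) // (@turan_numE q r a) //; last by lia.
(* For [a = 1] no vertex remains, and the default [2 ^ 0 = 1] is the right count. *)
case: b @a @q @r ra Em => [|b] a q r ra Em.
  have -> : r = 0 by rewrite /a in ra; lia.
  by rewrite muln0 turan_num0r; change (1 * q.+2 = q.+1 * 1 + 1); lia.
rewrite turan_numE //.
have -> : a - r = (b.+1 - r).+1 by rewrite /a; lia.
have -> : a - r.+1 = b.+1 - r by rewrite /a; lia.
by rewrite !expnS; lia.
Qed.

Lemma turan_num_gt0 n a : 0 < turan_num n a.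
Proof. by rewrite muln_gt0 !expn_gt0. Qed.

Lemma turan_num_ltS n a : turan_num n a < turan_num n.+1 a.
Proof.
case: a => [|a]; first by rewrite !turan_num0r ltn_exp2l.
by rewrite turan_numS // -[X in X < _]addn0 ltn_add2l turan_num_gt0.
Qed.

Lemma leq_turan_num a : {mono (turan_num^~ a) : m n / m <= n}.
Proof. by apply: leq_mono => m n; apply: (homo_ltn ltn_trans (turan_num_ltS^~ a)). Qed.

Lemma eq_turan_num a m n : turan_num m a = turan_num n a -> m = n.
Proof.
move=> E; apply/eqP.
by rewrite eqn_leq -(leq_turan_num a m) -(leq_turan_num a n) E leqnn.
Qed.

(** The left side counts the stable sets of a union of [a + b] cliques. [turan_numS] is applied on
    both sides, deleting from the part with the larger cliques: the clique removed there is at least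
    as large as the one removed on the right. The side conditions keep out the default value at
    [a = 0]. *)
Lemma turan_numM m n a b : (m == 0) || (0 < a) -> (n == 0) || (0 < b) ->
  turan_num m a * turan_num n b <= turan_num (m + n) (a + b).
Proof.
have [k] := ubnP (m + n); elim: k m n a b => // k IH.
have step m n a b : m.+1 + n <= k -> 0 < a -> (n == 0) || (0 < b) ->
    n <= b * (m %/ a).+1 ->
  turan_num m.+1 a * turan_num n b <= turan_num (m.+1 + n) (a + b).
  move=> lek a0 b0 len; set q := m %/ a in len *.
  have leq : q <= m by apply: leq_div.
  rewrite addSn !turan_numS //; last by rewrite addn_gt0 a0.
  rewrite mulnDl leq_add ?IH ?a0 ?orbT //.
  have Eb : (a + b).-1 = a.-1 + b by lia.
  apply: leq_trans (IH _ _ _ _ _ _ b0) _; first by rewrite -/q; lia.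
    rewrite -/q; case: (a) a0 @q len leq => [|[|c]] // _ q; rewrite /q ?divn1 ?subnn //.
    by rewrite orbT.
  rewrite Eb leq_turan_num -/q.
  have : (m + n) %/ (a + b) < q.+1.
    rewrite ltn_divLR ?addn_gt0 ?a0 // mulnDr -addSn leq_add ?(ltn_ceil m a0) //.
    by rewrite mulnC.
  by clearbody q; move: ((m + n) %/ _) => p; lia.
move=> m n a b ltk a0 b0.
have [/eqP|mn0] := posnP (m + n).
  rewrite addn_eq0 => /andP[/eqP-> /eqP->].
  by rewrite !turan_num0l.
case: m n a0 b0 ltk mn0 => [|m] [|n] //= a0 b0 ltk _.
- by rewrite mulnC addnC (addnC a); apply: step; rewrite ?addn0 //; lia.
- by apply: step; rewrite ?addn0 //; lia.
have [le|lt] := leqP (n %/ b) (m %/ a).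
  apply: step => //.
  by apply: leq_trans (ltn_ceil n b0) _; rewrite mulnC leq_mul2l ltnS le orbT.
rewrite mulnC addnC (addnC a); apply: step => //; first by rewrite addnC.
by apply: leq_trans (ltn_ceil m a0) _; rewrite mulnC leq_mul2l ltnS (ltnW lt) orbT.
Qed.

(** The product counts the stable sets of a union of cliques of orders [f i], added one at a time by
    [turan_numM]. *)
Lemma leq_prod_turan_num a (f : nat -> nat) :
  \prod_(i < a) (f i).+1 <= turan_num (\sum_(i < a) f i) a.
Proof.
elim: a => [|a IH]; first by rewrite !big_ord0.
case: a IH => [|a] IH; first by rewrite !big_ord1 turan_num1r.
rewrite big_ord_recr [X in turan_num X]big_ord_recr /=.
rewrite -[X in _ * X]turan_num1r -[X in _ <= turan_num _ X]addn1.
apply: leq_trans (leq_mul IH (leqnn _)) _.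
by apply: turan_numM; rewrite orbT.
Qed.

(** If two orders differed by more than one, moving a vertex from the larger clique to the smaller
    would keep the sum and raise the product above the bound of [leq_prod_turan_num]. *)
Lemma turan_num_balanced a (f : nat -> nat) :
    \prod_(i < a) (f i).+1 = turan_num (\sum_(i < a) f i) a ->
  forall i, i < a -> (\sum_(j < a) f j) %/ a <= f i <= ((\sum_(j < a) f j) %/ a).+1.
Proof.
move=> E.
have bal i j : i < a -> j < a -> f j <= (f i).+1.
  move=> ia ja; rewrite leqNgt; apply/negP => ltij.
  pose oi := Ordinal ia; pose oj := Ordinal ja.
  have neij : oj != oi by apply/eqP => /(congr1 val) /= ji; move: ltij; rewrite ji; lia.
  pose g k := if k == i then (f i).+1 else if k == j then (f j).-1 else f k.
  have gi : g oi = (f i).+1 by rewrite /g eqxx.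
  have gj : g oj = (f j).-1.
    by rewrite /g /= eqxx -[j == i]/(oj == oi) (negPf neij).
  have gk (k : 'I_a) : (k != oi) && (k != oj) -> g k = f k.
    by case/andP; rewrite /g -!val_eqE /= => /negPf-> /negPf->.
  have Esum : \sum_(k < a) g k = \sum_(k < a) f k.
    rewrite (bigD1 oi) //= (bigD1 oj) //= [RHS](bigD1 oi) //= [in RHS](bigD1 oj) //=.
    by rewrite (eq_bigr (fun k : 'I_a => f k)) ?gi ?gj => [|k /gk //]; lia.
  have := leq_prod_turan_num a g; rewrite Esum -E leqNgt => /negP; apply.
  rewrite (bigD1 oi) //= (bigD1 oj) //= [X in _ < X](bigD1 oi) //= [X in _ < _ * X](bigD1 oj) //=.
  rewrite [X in _ < _ * (_ * X)](eq_bigr (fun k : 'I_a => (f k).+1)) => [|k /gk-> //].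
  rewrite gi gj !mulnA ltn_mul2r prodn_gt0 //=.
  by rewrite prednK; nia.
move=> i ia; set s := \sum_(j < a) f j; have a0 : 0 < a by lia.
apply/andP; split; rewrite leqNgt; apply/negP => lti.
  have: s < (s %/ a) * a.
    apply: leq_trans (_ : (\sum_(j < a) s %/ a) <= _); last first.
      by rewrite sum_nat_const card_ord mulnC.
    rewrite [X in X < _](bigD1 (Ordinal ia)) //= [X in _ < X](bigD1 (Ordinal ia)) //=.
    rewrite -addSn leq_add //; apply: leq_sum => j _.
    by apply: leq_trans (bal _ _ ia (ltn_ord j)) _.
  by have := leq_divM s a; lia.
have: (s %/ a).+1 * a <= s.
  apply: leq_trans (_ : _ <= (\sum_(j < a) (s %/ a).+1)) _.
    by rewrite sum_nat_const card_ord mulnC.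
  by apply: leq_sum => j _; have := bal _ _ (ltn_ord j) ia; lia.
by have := ltn_ceil s a0; lia.
Qed.

(** T_{m,a} always has a clique of order [m %/ a], which is split off as a factor. *)
Lemma turan_num_factor m a : 0 < a ->
  turan_num m a = (m %/ a).+1 * turan_num (m - m %/ a) a.-1.
Proof.
case: a => // -[|b] _ /=.
  by rewrite turan_num1r divn1 subnn turan_num0l muln1.
set q := m %/ _; set r := m %% b.+2.
have rb : r <= b.+1 by rewrite -ltnS ltn_mod.
have Em : m = q * b.+2 + r by rewrite -divn_eq.
have -> : m - q = q * b.+1 + r by rewrite {1}Em mulnS; lia.
rewrite {1}Em !turan_numE //; last by lia.
by rewrite subSn // expnS mulnA.
Qed.

(** Of the [a - 1] cliques without the hub, [m %% a] have order [m %/ a + 1], and each loses its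
    neighbour of the hub. The condition on [a] is 1 <= a <= n - 1 for [n = m + 1], widened to admit
    the one-vertex graph. *)
Lemma spoke_numE m a : 0 < a <= maxn m 1 ->
  spoke_num m a = (m %/ a).+1 ^ (m %% a) * (m %/ a) ^ (a.-1 - m %% a).
Proof.
case: a => // -[|b] /= am; rewrite /spoke_num /=.
  by rewrite modn1 divn1 subnn turan_num0l.
have {}am : b.+2 <= m by lia.
set q := m %/ _; set r := m %% b.+2.
have rb : r <= b.+1 by rewrite -ltnS ltn_mod.
have Em : m = q * b.+2 + r by rewrite -divn_eq.
have q0 : 0 < q by rewrite divn_gt0.
have -> : m - q - b.+1 = q.-1 * b.+1 + r by case: q q0 Em => // k _ ->; rewrite /= mulSn mulnS; lia.
by rewrite turan_numE // prednK // mulnC.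
Qed.

(* Deleting one vertex from each clique. *)
Lemma spoke_num_factor m a : 0 < a <= maxn m 1 ->
  turan_num (m.+1 - a) a = (m %/ a).+1 * spoke_num m a.
Proof.
move=> oka; rewrite spoke_numE //; case: a oka => // -[|b] /= am.
  by rewrite subn1 turan_num1r divn1 modn1 muln1.
have {}am : b.+2 <= m by lia.
set q := m %/ _; set r := m %% b.+2.
have rb : r <= b.+1 by rewrite -ltnS ltn_mod.
have Em : m = q * b.+2 + r by rewrite -divn_eq.
have q0 : 0 < q by rewrite divn_gt0.
have -> : m.+1 - b.+2 = q.-1 * b.+2 + r.+1.
  by case: q q0 Em => // k _; rewrite mulSn; lia.
by rewrite turan_numE // prednK // subSS expnS; ring.
Qed.

(** Regrouped as [(u + v) * c + u * d], the left side is strictly increasing in [u + v] and in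
    [u]. *)
Lemma leq_mix u v U V c d : u <= U -> u + v <= U + V -> 0 < c -> 0 < d ->
  u * c + u * d + v * c <= U * c + U * d + V * c ?= iff (u == U) && (v == V).
Proof.
move=> uU uvUV c0 d0; apply/leqifP.
case: ifP => [/andP[/eqP-> /eqP->] //|].
move=> /negbT; rewrite negb_and => ne.
have -> : u * c + u * d + v * c = (u + v) * c + u * d by lia.
have -> : U * c + U * d + V * c = (U + V) * c + U * d by lia.
have [E|neu] := eqVneq u U.
  by rewrite E ltn_add2r ltn_pmul2r //; rewrite E eqxx /= in ne; lia.
by rewrite -addnS leq_add ?leq_mul2r ?uvUV ?orbT // ltn_pmul2r //; lia.
Qed.

(* The right-hand sides t1, s1, t2, s2 of the hypotheses describe two
   Turan-connected graphs with joined hubs. Write p1, p2 for the F-values of their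
   parts outside the cliques of the hubs: moving the spokes of the second hub to
   the first changes F by (p2 - s2) * (t1 - (m2 %/ a2 + 1) * s1) >= 0. *)
Lemma leq_bridge_num m1 m2 a1 a2 x x' y y' (m := (m1 + m2).+1) (a := a1 + a2) :
    0 < a1 <= maxn m1 1 -> 0 < a2 <= maxn m2 1 -> m2 %/ a2 <= m1 %/ a1 ->
    x <= turan_num m1 a1 -> x + x' <= turan_num m1 a1 + spoke_num m1 a1 ->
    y <= turan_num m2 a2 -> y + y' <= turan_num m2 a2 + spoke_num m2 a2 ->
    0 < y -> 0 < y' ->
  x * y + x * y' + x' * y <= turan_num m a + spoke_num m a /\
  (x * y + x * y' + x' * y = turan_num m a + spoke_num m a ->
   x * (y + y') = turan_num m a /\ x' * y = spoke_num m a \/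
   y * (x + x') = turan_num m a /\ y' * x = spoke_num m a).
Proof.
move=> ok1 ok2 leq21; set t1 := turan_num m1 a1; set s1 := spoke_num m1 a1.
set t2 := turan_num m2 a2; set s2 := spoke_num m2 a2 => lex lex' ley ley' y0 y'0.
have /andP[a10 _] := ok1; have /andP[a20 _] := ok2.
have t10 : 0 < t1 by apply: turan_num_gt0.
have s10 : 0 < s1 by apply: turan_num_gt0.
have E1 := leq_mix lex lex' y0 y'0.
have E2 := leq_mix ley ley' t10 s10.
have E3 : x * y + x * y' + x' * y <= t1 * t2 + t1 * s2 + s1 * t2
    ?= iff [&& x == t1, x' == s1, y == t2 & y' == s2].
  have -> : t1 * t2 + t1 * s2 + s1 * t2 = t2 * t1 + t2 * s1 + s2 * t1 by lia.
  rewrite [X in leqif _ _ X]andbA; apply: leqif_trans E1 _.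
  by have -> : t1 * y + t1 * y' + s1 * y = y * t1 + y * s1 + y' * t1 by lia.
pose p1 := turan_num (m1 - m1 %/ a1) a1.-1; pose p2 := turan_num (m2 - m2 %/ a2) a2.-1.
have Et1 : t1 = (m1 %/ a1).+1 * p1 by apply: turan_num_factor.
have Et2 : t2 = (m2 %/ a2).+1 * p2 by apply: turan_num_factor.
have Et2S : turan_num m2.+1 a2 = t2 + p2 by apply: turan_numS.
have Es2 : turan_num (m2.+1 - a2) a2 = (m2 %/ a2).+1 * s2 by apply: spoke_num_factor.
have lep1 : s1 <= p1 by rewrite leq_turan_num leq_subr.
have lep2 : s2 <= p2 by rewrite leq_turan_num leq_subr.
(* [L1] and [L2] concern the graph with all spokes at the first hub: its stable sets without that
   hub, and those containing it. *)
have L1 : t1 * (t2 + p2) <= turan_num m a.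
  rewrite -Et2S; apply: leq_trans (turan_numM _ _) _; rewrite ?a10 ?a20 ?orbT //.
  by rewrite addnS.
have L2 : s1 * ((m2 %/ a2).+1 * s2) <= spoke_num m a.
  rewrite -Es2; apply: leq_trans (turan_numM _ _) _; rewrite ?a20 ?orbT //.
    case: (a1) ok1 => [|[|b]] //=; last by rewrite orbT.
    by rewrite divn1 subnn.
  have -> : a1.-1 + a2 = a.-1 by rewrite /a; lia.
  rewrite /spoke_num leq_turan_num.
  have : m %/ a <= m1 %/ a1.
    rewrite -ltnS ltn_divLR ?addn_gt0 ?a10 // mulnDr /m -addnS -addSn leq_add //.
      exact: ltn_ceil.
    apply: leq_trans (ltn_ceil _ a20) _.
    by rewrite leq_mul2r ltnS leq21 orbT.
  have : m1 %/ a1 <= m1 - a1.-1.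
    case: (a1) ok1 => [|[|b]] // /andP[_ H]; rewrite ?divn1 ?subn0 //=.
    have {}H : b.+2 <= m1 by lia.
    by have := leq_divM m1 b.+2; case: (_ %/ _) => [|u]; nia.
  have : a1 <= m1.+1 by clear -ok1; lia.
  have : a2 <= m2.+1 by clear -ok2; lia.
  move: a10 a20; rewrite /m /a; move: (_ %/ _) (_ %/ _) => u v.
  by clear; lia.
have key : t1 * s2 + s1 * t2 <= t1 * p2 + s1 * ((m2 %/ a2).+1 * s2)
     ?= iff (s2 == p2) || (t1 == s1 * (m2 %/ a2).+1).
  have [u Ep2] : exists u, p2 = s2 + u by exists (p2 - s2); lia.
  have [w Et1'] : exists w, t1 = s1 * (m2 %/ a2).+1 + w.
    exists (t1 - s1 * (m2 %/ a2).+1); rewrite subnKC // Et1 mulnC.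
    by rewrite leq_mul.
  have -> : t1 * p2 + s1 * ((m2 %/ a2).+1 * s2) = t1 * s2 + s1 * t2 + w * u.
    by rewrite Et2 Et1' Ep2; ring.
  have -> : (s2 == p2) || (t1 == s1 * (m2 %/ a2).+1) = (w * u == 0).
    by rewrite muln_eq0 orbC Ep2 Et1'; lia.
  split; first exact: leq_addr.
  by rewrite -[X in X == _]addn0 eqn_add2l eq_sym.
have Lm : x * y + x * y' + x' * y <= t1 * t2 + (t1 * p2 + s1 * ((m2 %/ a2).+1 * s2)).
  by apply: leq_trans E3 _; rewrite -addnA leq_add2l; apply: key.
split; first by apply: leq_trans Lm _; rewrite addnA -mulnDr leq_add.
move=> E.
have EL1 : t1 * (t2 + p2) = turan_num m a by move: Lm L1 L2; rewrite E mulnDr; lia.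
have EL2 : s1 * ((m2 %/ a2).+1 * s2) = spoke_num m a by move: Lm L1 L2; rewrite E mulnDr; lia.
have := E3.2; rewrite E -EL1 -EL2.
have -> : (t1 * (t2 + p2) + s1 * ((m2 %/ a2).+1 * s2) == t1 * t2 + t1 * s2 + s1 * t2)
   = (t1 * s2 + s1 * t2 == t1 * p2 + s1 * ((m2 %/ a2).+1 * s2)) by lia.
have /eqP Ek : t1 * s2 + s1 * t2 == t1 * p2 + s1 * ((m2 %/ a2).+1 * s2).
  rewrite eqn_leq key.1 /=; have := E3.1; rewrite E -EL1 -EL2; lia.
rewrite Ek eqxx => /esym/and4P[/eqP-> /eqP-> /eqP-> /eqP->].
(* If [s2 = p2], the first hub gives the required counts. Otherwise [t1 = (m1 %/ a1).+1 * p1] is as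
   small as [lep1] and [leq21] allow; so [p1 = s1] and the quotients agree, and the second hub gives
   them. *)
have := key.2; rewrite Ek eqxx => /esym/orP[/eqP Es|/eqP Et].
  by left; rewrite [in t2]Et2 Es.
right.
have p10 : 0 < p1 by apply: turan_num_gt0.
have Ep : p1 = s1.
  apply/eqP; rewrite eqn_leq lep1 andbT -(@leq_pmul2r (m2 %/ a2).+1) // -Et Et1.
  by rewrite mulnC leq_mul2r ltnS leq21 orbT.
have Eq : m1 %/ a1 = m2 %/ a2.
  apply/succn_inj/eqP; rewrite -(@eqn_pmul2r p1) //.
  by rewrite -Et1 Et Ep mulnC.
by rewrite Et2 Et1 Ep Eq; split; ring.
Qed.

Lemma card_residue m a c : 0 < a -> c < a ->
  #|[set i : 'I_m.+1 | i %% a == c]| = m %/ a + (c <= m %% a).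
Proof.
move=> a0 ca; rewrite -sum1_card big_mkcond /=.
under eq_bigr => i _ do rewrite inE -[if _ then 1 else 0]/(nat_of_bool _).
elim: m => [|m IH]; first by rewrite big_ord_recr big_ord0 /= div0n mod0n leqn0 eq_sym.
rewrite big_ord_recr /= IH; move: (divn_eq m a) (ltn_pmod m a0).
move: (m %/ a) (m %% a) => q r -> ra.
have [Er|ner] := eqVneq r.+1 a.
  have -> : (q * a + r).+1 = q.+1 * a by rewrite -addnS Er mulSnr.
  rewrite modnMl mulnK // leqn0 [0 == c]eq_sym.
  have -> : c <= r by rewrite -ltnS Er.
  by rewrite addn1.
have ra1 : r.+1 < a by rewrite ltn_neqAle ner.
rewrite -addnS modnMDl divnMDl // modn_small // divn_small // addn0 -addnA.
congr (_ + _); rewrite [in RHS]leq_eqVlt ltnS [r.+1 == c]eq_sym.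
by case: eqVneq => [->|]; rewrite ?ltnn ?addn0.
Qed.

Lemma prod_step b r x : r <= b ->
  \prod_(i < b) (x + (i < r)) = x.+1 ^ r * x ^ (b - r).
Proof.
elim: b r => [|b IH] r; first by rewrite leqn0 => /eqP->; rewrite big_ord0.
rewrite leq_eqVlt => /orP[/eqP->|].
  rewrite subnn muln1 (eq_bigr (fun=> x.+1)) => [|i _]; last by rewrite ltn_ord addn1.
  by rewrite prod_nat_const card_ord.
rewrite ltnS => rb; rewrite big_ord_recr /= IH // subSn // expnSr mulnA.
by rewrite ltnNge rb addn0.
Qed.

(** * Stable sets inside a vertex set *)

Section Graph.
Variable T : finType.
Implicit Types (e : rel T) (A B S U W : {set T}) (v x y z : T).

(** These notions are relative to a vertex set and a relation, so that induced subgraphs and deleted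
    edges stay on one vertex type. *)
Definition indep e S := [forall x in S, forall y in S, ~~ e x y].
Definition nfib e A := #|[set S : {set T} | (S \subset A) && indep e S]|.
Definition alpha e A := \max_(S : {set T} | (S \subset A) && indep e S) #|S|.
Definition nbhd e v := [set w | (w == v) || e v w].
Definition deg e A v := #|[set w in A | e v w]|.
(** Stated by cuts instead of paths, since the proofs use it to find an edge leaving a given
    part. *)
Definition conn e A := A != set0 /\
  forall U, U \subset A -> U != set0 -> U != A ->
    exists x y, [/\ x \in U, y \in A :\: U & e x y].

Lemma indepP e S : reflect {in S &, forall x y, ~~ e x y} (indep e S).
Proof.
apply: (iffP forall_inP) => [H x y xS yS|H x xS].
  by move/forall_inP: (H x xS); apply.
by apply/forall_inP => y yS; apply: H.
Qed.

Lemma indepS e S U : S \subset U -> indep e U -> indep e S.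
Proof. by move=> /subsetP sub /indepP H; apply/indepP => x y /sub xU /sub; apply: H. Qed.

Lemma indep0 e : indep e set0.
Proof. by apply/indepP => x y; rewrite inE. Qed.

Lemma alphaP e A S : S \subset A -> indep e S -> #|S| <= alpha e A.
Proof. by move=> SA iS; apply: (bigmax_sup S); rewrite ?SA. Qed.

Lemma alpha_ex e A : exists S, [/\ S \subset A, indep e S & #|S| = alpha e A].
Proof.
pose P := [pred S : {set T} | (S \subset A) && indep e S].
have P0 : 0 < #|P| by apply/card_gt0P; exists set0; rewrite inE sub0set indep0.
have [S /andP[SA iS] E] := eq_bigmax_cond (fun S : {set T} => #|S|) P0.
by exists S; split=> //; rewrite -E.
Qed.

Lemma alpha_leP e A a :
  (forall S, S \subset A -> indep e S -> #|S| <= a) <-> alpha e A <= a.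
Proof.
split=> [H|H S SA iS]; last exact: leq_trans (alphaP SA iS) H.
by have [S [SA iS <-]] := alpha_ex e A; apply: H.
Qed.

Lemma leq_alpha e A B : A \subset B -> alpha e A <= alpha e B.
Proof. by move=> AB; apply/alpha_leP => S SA; apply: alphaP; apply: subset_trans AB. Qed.

Lemma nfib_gt0 e A : 0 < nfib e A.
Proof. by apply/card_gt0P; exists set0; rewrite inE sub0set indep0. Qed.

Lemma nfib0 e : nfib e set0 = 1.
Proof.
apply/eqP/cards1P; exists set0; apply/setP => S; rewrite !inE subset0.
by case: eqP => // ->; rewrite indep0.
Qed.

Lemma eq_alpha e e' A : {in A &, e =2 e'} -> alpha e A = alpha e' A.
Proof.
move=> E; apply: eq_bigl => S; case: (boolP (S \subset A)) => //= /subsetP SA.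
by apply/indepP/indepP => H x y xS yS; have := H x y xS yS; rewrite E ?SA.
Qed.

Variable e : rel T.
Hypotheses (sym : symmetric e) (irr : irreflexive e).

Lemma indepU1 v S : indep e S -> {in S, forall y, ~~ e v y} -> indep e (v |: S).
Proof.
move=> /indepP iS H; apply/indepP => x y /setU1P[->|xS] /setU1P[->|yS].
- by rewrite irr.
- exact: H.
- by rewrite sym H.
- exact: iS.
Qed.

Lemma indep_setU U W : indep e U -> indep e W -> {in U & W, forall x y, ~~ e x y} ->
  indep e (U :|: W).
Proof.
move=> /indepP iU /indepP iW H; apply/indepP => x y /setUP[xU|xW] /setUP[yU|yW].
- exact: iU.
- exact: H.
- by rewrite sym H.
- exact: iW.
Qed.

(** The stable sets containing [v] are the [v |: S] with [S] stable in [A :\: nbhd e v]. *)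
Lemma nfib_rec v A : v \in A -> nfib e A = nfib e (A :\ v) + nfib e (A :\: nbhd e v).
Proof.
move=> vA; rewrite /nfib -(cardsID [set S : {set T} | v \in S]) addnC; congr (_ + _).
  apply: eq_card => S; rewrite !inE subsetD1.
  by case: (v \in S); rewrite ?andbF //= andbT.
rewrite -[RHS](card_in_imset (f := fun S : {set T} => v |: S)); last first.
  move=> S1 S2; rewrite !inE !subsetD => /andP[/andP[_ d1] _] /andP[/andP[_ d2] _] E.
  have vN : v \in nbhd e v by rewrite inE eqxx.
  by rewrite -(setU1K (negbT (disjointFl d1 vN))) E setU1K // (disjointFl d2 vN).
apply: eq_card => S; rewrite !inE; apply/andP/imsetP => [[/andP[SA iS] vS]|[S']].
  exists (S :\ v); last by rewrite setD1K.
  rewrite inE subsetD (subset_trans (subD1set _ _) SA) (indepS (subD1set _ _) iS) andbT /=.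
  rewrite disjoints_subset; apply/subsetP => y; rewrite !inE negb_or => /andP[-> yS].
  by move/indepP: iS; apply.
rewrite inE subsetD => /andP[/andP[SA dS] iS] ->; rewrite setU11 subUset sub1set vA SA /=.
split=> //; apply: indepU1 => // y yS; apply: contraFN (disjointFr dS yS).
by rewrite inE => ->; rewrite orbT.
Qed.

(** Apply [nfib_rec] at a vertex of [U] on both sides; both deletions leave [W] intact. *)
Lemma nfib_setU U W : [disjoint U & W] -> {in U & W, forall x y, ~~ e x y} ->
  nfib e (U :|: W) = nfib e U * nfib e W.
Proof.
have [k] := ubnP #|U|; elim: k U => // k IH U ltk dUW H.
have [->|[v vU]] := set_0Vmem U; first by rewrite set0U nfib0 mul1n.
have vW : v \notin W by rewrite (disjointFr dUW vU).
rewrite (nfib_rec vU) (@nfib_rec v (U :|: W)) ?inE ?vU // mulnDl.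
have sub B : nfib e ((U :\: B) :|: W) = nfib e (U :\: B) * nfib e W \/ v \notin B.
  case: (boolP (v \in B)) => [vB|]; [left|by right].
  apply: IH; last by move=> x y /setDP[xU _]; apply: H.
    rewrite -ltnS (leq_trans _ ltk) // ltnS proper_card // properE subsetDl /=.
    by apply/subsetPn; exists v; rewrite ?inE ?vB.
  by apply: disjointWl dUW; apply: subsetDl.
have [<-|] := sub [set v]; last by rewrite inE eqxx.
have [<-|] := sub (nbhd e v); last by rewrite inE eqxx.
congr (nfib e _ + nfib e _); rewrite setDUl; congr (_ :|: _); apply/setDidPl.
  by rewrite disjoint_sym disjoints1.
rewrite disjoint_subset; apply/subsetP => y yW; rewrite !inE negb_or.
by rewrite H // andbT; apply: contraNneq vW => <-.
Qed.

Lemma card_setD_nbhd v A : v \in A -> #|A :\: nbhd e v| = #|A|.-1 - deg e A v.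
Proof.
move=> vA; rewrite -[in RHS](cardsID (nbhd e v) A).
have -> : A :&: nbhd e v = v |: [set w in A | e v w].
  by apply/setP => w; rewrite !inE; case: eqP => [->|]; rewrite ?vA //= andbT.
by rewrite cardsU1 !inE irr andbF add1n addSn /= addKn.
Qed.

Lemma alpha_setD_nbhd v A : v \in A -> alpha e (A :\: nbhd e v) < alpha e A.
Proof.
move=> vA; have [S [SA iS <-]] := alpha_ex e (A :\: nbhd e v).
have vS : v \notin S.
  by apply/negP => /(subsetP SA); rewrite !inE eqxx.
have -> : #|S|.+1 = #|v |: S| by rewrite cardsU1 vS.
apply: alphaP; first by rewrite subUset sub1set vA (subset_trans SA) // subsetDl.
apply: indepU1 => // y /(subsetP SA); rewrite !inE negb_or.
by case/andP => /andP[].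
Qed.

Lemma deg_le v A : v \in A -> deg e A v <= #|A|.-1.
Proof.
move=> vA; rewrite [#|A|](cardsD1 v) vA /=; apply: subset_leq_card.
apply/subsetP => w; rewrite !inE => /andP[-> evw]; rewrite andbT.
by apply: contraTneq evw => ->; rewrite irr.
Qed.

(** Deleting a closed neighbourhood removes at most [d + 1] vertices and lowers the stability
    number. *)
Lemma card_le_alpha_deg A d : {in A, forall v, deg e A v <= d} -> #|A| <= alpha e A * d.+1.
Proof.
have [k] := ubnP #|A|; elim: k A => // k IH A ltk H.
have [->|[v vA]] := set_0Vmem A; first by rewrite cards0.
have ltD : #|A :\: nbhd e v| < #|A|.
  rewrite proper_card // properE subsetDl /=.
  by apply/subsetPn; exists v; rewrite ?inE ?eqxx.
have HD : {in A :\: nbhd e v, forall w, deg e (A :\: nbhd e v) w <= d}.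
  move=> w /setDP[wA _]; apply: leq_trans (H w wA); apply: subset_leq_card.
  by apply/subsetP => z; rewrite !inE => /andP[/andP[_ ->] ->].
have := IH _ (leq_trans ltD ltk) HD; rewrite card_setD_nbhd //.
move=> le1; apply: leq_trans (_ : (alpha e (A :\: nbhd e v)).+1 * d.+1 <= _).
  rewrite mulSn; have := H v vA; have := deg_le vA.
  have : 0 < #|A| by rewrite card_gt0; apply/set0Pn; exists v.
  by move: (_ * _) (deg _ _ _) #|A| le1 => *; lia.
by rewrite leq_mul2r alpha_setD_nbhd ?orbT.
Qed.

(* Grow an independent set greedily from one vertex, each new vertex being
   chosen next to the part dominated so far: it then dominates at most d
   vertices that are not dominated yet. *)
Lemma conn_card_le A d : conn e A -> {in A, forall v, deg e A v <= d} ->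
  #|A| <= (alpha e A * d).+1.
Proof.
move=> [/set0Pn[v0 v0A] cA] H.
pose dom S := [set w in A | (w \in S) || [exists s in S, e s w]].
(* The first vertex dominates at most [d + 1] vertices, itself included, and each later one adds at
   most [d]. A largest such [S] dominates all of [A]. *)
pose P S := [&& S \subset A, indep e S, S != set0 & #|dom S| <= (#|S| * d).+1].
have P1 : P [set v0].
  rewrite /P sub1set v0A -card_gt0 cards1 mul1n /=; apply/andP; split.
    by apply/indepP => x y /set1P-> /set1P->; rewrite irr.
  apply: leq_trans (_ : #|v0 |: [set w in A | e v0 w]| <= _).
    apply/subset_leq_card/subsetP => w; rewrite !inE => /andP[->].
    by case/orP=> [->//|/exists_inP[s /set1P-> ->]]; rewrite orbT.
  by rewrite cardsU1 (leq_add (leq_b1 _)) // H.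
have [S /and4P[SA iS S0 leS] maxS] := arg_maxnP (fun S : {set T} => #|S|) P1.
have [EA|neA] := eqVneq (dom S) A.
  by rewrite -{1}EA (leq_trans leS) // ltnS leq_mul2r alphaP ?orbT.
have domA : dom S \subset A by apply/subsetP => w; rewrite inE => /andP[].
have Sdom : S \subset dom S by apply/subsetP => w wS; rewrite inE wS (subsetP SA).
have dom0 : dom S != set0 by apply: contraNneq S0 => E; rewrite -subset0 -E.
have [x [w [xD /setDP[wA wD] exw]]] := cA _ domA dom0 neA.
have wS : w \notin S by apply: contra wD; apply: (subsetP Sdom).
have : P (w |: S).
  rewrite /P subUset sub1set wA SA /=; apply/and3P; split.
  - apply: indepU1 => // y yS; apply: contra wD => ewy.
    by rewrite inE wA; apply/orP; right; apply/exists_inP; exists y; rewrite // sym.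
  - by apply/set0Pn; exists w; rewrite setU11.
  (* As [x] is already dominated, [w] adds at most itself and its neighbours other than [x]. *)
  set R := [set z in A | e w z] :\ x.
  have ltR : #|R| < d.
    have xw : x \in [set z in A | e w z] by rewrite inE (subsetP domA) //= sym.
    by apply: leq_trans (H w wA); rewrite /deg [X in _ < X](cardsD1 x) xw.
  have sub : dom (w |: S) \subset dom S :|: (w |: R).
    apply/subsetP => z; rewrite !inE => /andP[zA /orP[/orP[->|zS]|/exists_inP[s]]].
    - by rewrite orbT.
    - by rewrite zA zS.
    rewrite !inE => /orP[/eqP->|sS] esz; last first.
      by rewrite zA; case: existsP => [_|[]]; [rewrite orbT | exists s; rewrite sS].
    by have [->|nzx] := eqVneq z x; [move: xD; rewrite inE => -> | rewrite zA esz !orbT].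
  apply: leq_trans (subset_leq_card sub) _.
  apply: leq_trans (leq_card_setU _ _) _.
  rewrite cardsU1 cardsU1 wS add1n mulSn -addnS addnC leq_add //.
  by apply: leq_trans ltR; rewrite -add1n leq_add2r leq_b1.
by move/maxS => /=; rewrite cardsU1 wS add1n ltnn.
Qed.

End Graph.

(** * Turan's bound *)

Section Cluster.
Variables (T : finType) (e : rel T).
Hypotheses (sym : symmetric e) (irr : irreflexive e).
Implicit Types (A B S U W : {set T}) (v x y z : T) (c : T -> nat).

Definition cluster A := {in A & &, forall x y z, e x y -> e y z -> x != z -> e x z}.
Definition cluster_coloring A a c := {in A, forall x, c x < a} /\
  {in A &, forall x y, e x y = (x != y) && (c x == c y)}.
Definition color_class c A i := [set x in A | c x == i].

Lemma coloring_cluster A a c : cluster_coloring A a c -> cluster A.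
Proof.
move=> [_ H] x y z xA yA zA; rewrite !H // => /andP[_ /eqP->] /andP[_ ->] ->.
by [].
Qed.

Lemma cluster_coloringS A B a c : B \subset A -> cluster_coloring A a c -> cluster_coloring B a c.
Proof.
move=> /subsetP sub [H1 H2]; split=> [x /sub/H1 //|x y /sub xA /sub yA].
exact: H2.
Qed.

(** The clique of a vertex [v] is its closed neighbourhood. It receives the last color, and its
    removal lowers the stability number. *)
Lemma cluster_has_coloring A a : cluster A -> alpha e A <= a -> exists c, cluster_coloring A a c.
Proof.
have [k] := ubnP #|A|; elim: k A a => // k IH A a ltk clA lea.
have [->|[v vA]] := set_0Vmem A.
  by exists (fun=> 0); split=> [x|x y]; rewrite inE.
have ltal := alpha_setD_nbhd sym irr vA.
have [] := IH (A :\: nbhd e v) a.-1.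
- rewrite -ltnS (leq_trans _ ltk) // ltnS proper_card // properE subsetDl /=.
  by apply/subsetPn; exists v; rewrite ?inE ?eqxx.
- by move=> x y z /setDP[xA _] /setDP[yA _] /setDP[zA _]; apply: clA.
- by lia.
move=> c [c1 c2]; exists (fun x => if x \in nbhd e v then a.-1 else c x).
have inD x : x \in A -> x \notin nbhd e v -> x \in A :\: nbhd e v.
  by move=> xA xN; rewrite inE xN.
have Ne x y : x \in A -> y \in A -> x \in nbhd e v -> y \notin nbhd e v -> e x y = false.
  move=> xA yA; rewrite !inE negb_or => /orP[/eqP->|evx] /andP[nyv Nevy].
    exact: negbTE.
  by apply: contraNF Nevy => exy; apply: (clA v x y); rewrite // eq_sym.
split=> [x xA|x y xA yA].
  by case: ifPn => xN; [lia | apply: leq_trans (c1 _ (inD x xA xN)) (leq_pred _)].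
case: ifPn => xN; case: ifPn => yN.
- rewrite eqxx andbT; apply/idP/idP => [exy|nxy].
    by apply: contraTneq exy => ->; rewrite irr.
  move: xN yN nxy; rewrite !inE => /orP[/eqP->|evx] /orP[/eqP->|evy]; rewrite ?eqxx //.
    by rewrite sym.
  by move=> nxy; apply: (clA x v y); rewrite // sym.
- by rewrite Ne // gtn_eqF ?andbF // c1 ?inD.
- by rewrite sym Ne // ltn_eqF ?andbF // c1 ?inD.
- by apply: c2; apply: inD.
Qed.

(** In [nfib_rec] at [v] only the factor of the clique of [v] changes: for order [k] the identity is
    [k + 1] for the whole, [k] without [v] and 1 without the clique. *)
Lemma coloring_nfib A a c : cluster_coloring A a c ->
  nfib e A = \prod_(i < a) #|color_class c A i|.+1.
Proof.
have [k] := ubnP #|A|; elim: k A => // k IH A ltk colA.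
have [A0|[v vA]] := set_0Vmem A.
  rewrite A0 nfib0 big1 // => i _; congr _.+1; apply/eqP; rewrite cards_eq0.
  by apply/eqP/setP => x; rewrite !inE.
have [c1 c2] := colA; pose o := Ordinal (c1 v vA).
have lt1 B : v \in B -> #|A :\: B| < k.
  move=> vB; rewrite -ltnS (leq_trans _ ltk) // ltnS proper_card // properE subsetDl /=.
  by apply/subsetPn; exists v; rewrite ?inE ?vB.
have S1 B : cluster_coloring (A :\: B) a c by apply: cluster_coloringS colA; apply: subsetDl.
rewrite (nfib_rec sym irr vA) (IH _ (lt1 [set v] (set11 v)) (S1 _)).
rewrite (IH _ (lt1 (nbhd e v) _) (S1 _)) ?inE ?eqxx //.
rewrite (bigD1 o) //= [X in _ + X](bigD1 o) //= [RHS](bigD1 o) //=.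
rewrite (eq_bigr (fun i : 'I_a => #|color_class c A i|.+1)) => [|i ni]; last first.
  congr _.+1; apply: eq_card => x; rewrite !inE; case: (eqVneq x v) => //= ->.
  by rewrite [c v == i]eq_sym -[_ == c v]/(i == o) (negPf ni) andbF.
rewrite [X in _ + _ * X](eq_bigr (fun i : 'I_a => #|color_class c A i|.+1)) => [|i ni]; last first.
  congr _.+1; apply: eq_card => x; rewrite !inE; case: (boolP (x \in A)) => xA; rewrite ?andbF //=.
  rewrite andbT; case: (c x =P i) => [Ei|]; rewrite ?andbF // andbT.
  rewrite c2 // Ei; apply/norP; split; last first.
    by rewrite [c v == _]eq_sym -[_ == c v]/(i == o) (negPf ni) andbF.
  by apply: contraNneq ni => Exv; apply/eqP/val_inj; rewrite /= -Ei Exv.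
rewrite -mulnDl; congr (_ * _).
have -> : color_class c (A :\: nbhd e v) (c v) = set0.
  apply/setP => x; rewrite !inE; apply/negP => /andP[/andP[]].
  rewrite negb_or => /andP[nxv] H xA /eqP Ex; move: H.
  by rewrite c2 // eq_sym nxv Ex eqxx.
rewrite cards0 addn1 [in RHS](cardsD1 v) !inE vA eqxx /=; congr _.+2.
by apply: eq_card => x; rewrite !inE andbA.
Qed.

Lemma card_coloring A a c : cluster_coloring A a c -> \sum_(i < a) #|color_class c A i| = #|A|.
Proof.
move=> [c1 _]; rewrite -sum1_card.
rewrite [LHS](eq_bigr (fun i : 'I_a => \sum_(x in color_class c A i) 1)) => [|i _]; last first.
  by rewrite sum1_card.
rewrite (exchange_big_dep (mem A)) /=; last by move=> i x _; rewrite inE => /andP[].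
apply: eq_bigr => x xA; rewrite (bigD1 (Ordinal (c1 x xA))) /=; last by rewrite inE xA eqxx.
by rewrite big1 // => i /andP[]; rewrite inE -val_eqE /= => /andP[_ /eqP->]; rewrite eqxx.
Qed.

(** Otherwise every class has a vertex not adjacent to [v], and these vertices together with [v]
    form a stable set of size [a + 1]. *)
Lemma coloring_full_class A a c v : cluster_coloring A a c -> v \notin A ->
    alpha e (v |: A) <= a ->
  exists2 i, i < a & color_class c A i \subset [set w | e v w].
Proof.
move=> [c1 c2] vA lea.
case: (boolP [exists i : 'I_a, color_class c A i \subset [set w | e v w]]) => [/existsP[i]|].
  by exists i.
rewrite negb_exists => /forallP H.
have /fin_all_exists[f Hf] (i : 'I_a) : exists x, [/\ x \in A, c x = i & ~~ e v x].
  by have /subsetPn[x] := H i; rewrite !inE => /andP[xA /eqP Ex] Nvx; exists x.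
have injf : injective f.
  move=> i j E; apply: val_inj; have [_ Ei _] := Hf i; have [_ Ej _] := Hf j.
  by rewrite /= -Ei -Ej E.
pose S := [set f i | i : 'I_a].
have SA : S \subset A by apply/subsetP => _ /imsetP[i _ ->]; have [] := Hf i.
have : #|v |: S| <= a.
  apply: leq_trans lea; apply: alphaP; first by rewrite setUS.
  apply: indepU1 => // [|_ /imsetP[i _ ->]]; last by have [] := Hf i.
  apply/indepP => _ _ /imsetP[i _ ->] /imsetP[j _ ->].
  have [iA Ei _] := Hf i; have [jA Ej _] := Hf j.
  rewrite c2 // Ei Ej; apply/negP => /andP[nij /eqP Eij].
  by case/eqP: nij; congr f; apply: val_inj.
rewrite cardsU1 card_imset // card_ord; case: (boolP (v \in S)) => [/(subsetP SA)|_].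
  by rewrite (negPf vA).
by rewrite ltnn.
Qed.

Lemma turan_coloring_balanced A a c : cluster_coloring A a c ->
    nfib e A = turan_num #|A| a ->
  forall i, i < a -> #|A| %/ a <= #|color_class c A i| <= (#|A| %/ a).+1.
Proof.
move=> colA; rewrite (coloring_nfib colA) -(card_coloring colA).
exact: (@turan_num_balanced a (fun i => #|color_class c A i|)).
Qed.

Lemma max_deg A : A != set0 ->
  exists2 v, v \in A & {in A, forall w, deg e A w <= deg e A v}.
Proof.
by case/set0Pn=> v0 v0A; have [v vA H] := arg_maxnP (deg e A) v0A; exists v.
Qed.

(** For [v] of maximum degree, [card_le_alpha_deg] gives [m %/ a <= deg e A v], so the two terms of
    [nfib_rec] are bounded by those of [turan_numS]. Equality makes [A :\ v] a balanced union of
    cliques and fixes the degree of [v]. *)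
Lemma turan_bound A a : alpha e A <= a ->
  nfib e A <= turan_num #|A| a /\ (nfib e A = turan_num #|A| a -> cluster A).
Proof.
have [k] := ubnP #|A|; elim: k A a => // k IH A a ltk lea.
have [->|A0] := eqVneq A set0.
  by rewrite nfib0 cards0 turan_num0l; split=> // _ x y z; rewrite inE.
have [v vA maxv] := max_deg A0.
have [m Em] : exists m, #|A| = m.+1.
  by exists #|A|.-1; rewrite prednK // card_gt0.
have Em1 : #|A :\ v| = m by move: Em; rewrite (cardsD1 v) vA => -[].
have dm : deg e A v <= m by have := deg_le irr vA; rewrite Em.
have led : m.+1 <= a * (deg e A v).+1.
  rewrite -Em; apply: leq_trans (card_le_alpha_deg sym irr maxv) _.
  by rewrite leq_mul2r lea orbT.
have a0 : 0 < a by move: led; case: (a).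
have leq : m %/ a <= deg e A v by rewrite -ltnS ltn_divLR // mulnC.
have [||le1 eq1] := IH (A :\ v) a; first by rewrite Em1 -ltnS -Em.
  exact: leq_trans (leq_alpha _ (subD1set _ _)) lea.
have [le2 _] : nfib e (A :\: nbhd e v) <= turan_num (m - deg e A v) a.-1 /\
   (nfib e (A :\: nbhd e v) = turan_num (m - deg e A v) a.-1 -> cluster (A :\: nbhd e v)).
  rewrite -[m in m - _]/(m.+1.-1) -Em -card_setD_nbhd //; apply: IH.
    rewrite card_setD_nbhd // Em /=; lia.
  by have := alpha_setD_nbhd sym irr vA; lia.
rewrite Em1 in le1 eq1.
have le3 : turan_num (m - deg e A v) a.-1 <= turan_num (m - m %/ a) a.-1.
  by rewrite leq_turan_num leq_sub2l.
rewrite Em turan_numS // (nfib_rec sym irr vA); split.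
  by rewrite leq_add // (leq_trans le2).
move=> E.
have E1 : nfib e (A :\ v) = turan_num m a by lia.
have /eq_turan_num E2 : turan_num (m - deg e A v) a.-1 = turan_num (m - m %/ a) a.-1 by lia.
have Ed : deg e A v = m %/ a by have := leq_div m a; lia.
have [c colc] := cluster_has_coloring (eq1 E1) (leq_trans (leq_alpha _ (subD1set A v)) lea).
have [|i ia sub] := coloring_full_class colc (negbT (setD11 _ _)); first by rewrite setD1K.
have := turan_coloring_balanced colc; rewrite Em1 => /(_ E1 i ia)/andP[bal _].
(* The class has at least [m %/ a] vertices, which is the degree of [v]; hence it is the whole
   neighbourhood, and [v] joins it. *)
have Ecl : color_class c (A :\ v) i = [set w in A | e v w].
  apply/eqP; rewrite eqEcard -[X in _ && (X <= _)]/(deg e A v) Ed bal andbT.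
  apply/subsetP => w wc; have := subsetP sub w wc.
  by move: wc; rewrite !inE => /andP[/andP[_ ->]].
have [c1 c2] := colc.
have evE w : w \in A -> w != v -> e v w = (c w == i).
  by move=> wA nwv; move/setP/(_ w): Ecl; rewrite !inE nwv wA.
apply: (@coloring_cluster A a (fun w => if w == v then i else c w)).
split=> [w wA|x y xA yA].
  by case: eqVneq => // nwv; apply: c1; rewrite !inE nwv.
case: (eqVneq x v) => [->|nx]; case: (eqVneq y v) => [->|ny].
- by rewrite irr eqxx.
- by rewrite evE // eq_sym ny eq_sym.
- by rewrite sym evE // nx.
- by rewrite c2 // !inE ?nx ?ny.
Qed.

End Cluster.

(** * Recognizing Turan-connected graphs *)

(** The adjacency of [turan_connected] on plain numbers. *)
Definition tc_adj a i j :=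
  (i != j) && [|| i == j %[mod a], (i == 0) && (0 < j < a) | (j == 0) && (0 < i < a)].

Section TuranConnected.
Variables (T : finType) (e : rel T).
Hypotheses (sym : symmetric e) (irr : irreflexive e).
Implicit Types (A B S U W : {set T}) (v x y z : T) (c : T -> nat).

(** Injectivity and the bound make [f] a bijection onto the labels below [#|A|], hence an
    isomorphism with TC_{n,a} for [n = #|A|]. *)
Definition tc_like A a := exists f : T -> nat,
  [/\ {in A &, injective f}, {in A, forall x, f x < #|A|}
    & {in A &, forall x y, e x y = tc_adj a (f x) (f y)}].

(* The hub is [u j], and [u i] is its neighbour in the class of color [i]. *)
Lemma star_tc_like A a c (u : nat -> T) j q :
    {in A, forall y, c y < a} -> j < a ->
    (forall i, i < a -> u i \in A /\ c (u i) = i) ->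
    (forall i, i < a -> q <= #|color_class c A i| <= q.+1) ->
    #|color_class c A j| = q.+1 -> \sum_(i < a) #|color_class c A i| = #|A| ->
    {in A &, forall y z, e y z = (y != z) &&
      [|| c y == c z, (y == u j) && (z == u (c z)) | (z == u j) && (y == u (c y))]} ->
  tc_like A a.
Proof.
move=> cA ja uA szC szj sumC adjE.
have a0 : 0 < a by apply: leq_ltn_trans ja.
pose big i := #|color_class c A i| == q.+1.
(* Residues number the classes: the class of the hub first, then the other large ones, then the
   small ones, so that the labels fill an initial segment. *)
pose Lb := j :: [seq i <- iota 0 a | (i != j) && big i].
pose Ls := [seq i <- iota 0 a | ~~ big i].
have bigj : big j by rewrite /big szj.
have memL i : (i \in Lb ++ Ls) = (i < a).
  rewrite mem_cat inE !mem_filter mem_iota add0n /=.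
  by case: (eqVneq i j) => [->|_] //=; case: (big i); rewrite ?orbF.
have uniqL : uniq (Lb ++ Ls).
  rewrite cat_uniq /= mem_filter eqxx /= !filter_uniq ?iota_uniq //= andbT.
  apply/hasPn => i; rewrite mem_filter inE mem_filter => /andP[nbi _].
  by rewrite (negPf nbi) andbF orbF; apply: contraNneq nbi => ->.
have permL : perm_eq (Lb ++ Ls) (iota 0 a).
  by apply: uniq_perm (iota_uniq _ _) _ => // i; rewrite memL mem_iota.
have sizeL : size Lb + size Ls = a by rewrite -size_cat (perm_size permL) size_iota.
have cardA : #|A| = size Lb + a * q.
  rewrite -sumC -(big_mkord xpredT (fun i => #|color_class c A i|)) /index_iota subn0.
  rewrite -(perm_big _ permL) big_cat /=.
  rewrite (eq_big_seq (fun=> q.+1)) => [|i]; last first.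
    by rewrite inE mem_filter => /orP[/eqP->//|/andP[/andP[_ /eqP]]].
  rewrite [X in _ + X](eq_big_seq (fun=> q)) => [|i]; last first.
    rewrite mem_filter mem_iota => /andP[nb /szC]; rewrite /big in nb.
    by move: nb => /eqP; lia.
  rewrite !big_const_seq !count_predT !iter_addn_0.
  change (q.+1 * size Lb + q * size Ls = size Lb + a * q).
  by move: sizeL; generalize (size Lb) (size Ls) => p1 p2 <-; ring.
pose s i := index i (Lb ++ Ls).
have s_lt i : i < a -> s i < a by rewrite -memL -index_mem size_cat sizeL.
have s_inj i k : i < a -> k < a -> s i = s k -> i = k.
  by rewrite -!memL => iL kL E; rewrite -(nth_index 0 iL) -(nth_index 0 kL) -!/(s _) E.
have s_big i : i < a -> big i -> s i < size Lb.
  move=> ia bi; rewrite /s index_cat.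
  have -> : i \in Lb by rewrite inE mem_filter mem_iota ia bi !andbT orbN.
  rewrite index_mem inE mem_filter mem_iota ia bi !andbT; exact: orbN.
have sj : s j = 0 by rewrite /s /= eqxx.
(* With [u i] first in its class, exactly these vertices get labels below [a], and the hub gets
   0. *)
pose L i := u i :: enum (color_class c A i :\ u i).
pose r y := index y (L (c y)).
have ucl i : i < a -> u i \in color_class c A i by move=> /uA[uiA ci]; rewrite inE uiA ci eqxx.
have memr y : y \in A -> y \in L (c y).
  by move=> yA; rewrite inE mem_enum !inE yA eqxx !andbT orbN.
have r_lt y : y \in A -> r y < #|color_class c A (c y)|.
  move=> yA; have := memr y yA; rewrite -index_mem /= -cardE.
  by rewrite [X in _ -> _ < X](cardsD1 (u (c y))) ucl ?cA.
pose f y := r y * a + s (c y).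
have fmod y : y \in A -> f y %% a = s (c y).
  by move=> yA; rewrite /f modnMDl modn_small // s_lt // cA.
have fdiv y : y \in A -> f y %/ a = r y.
  by move=> yA; rewrite /f divnMDl // divn_small ?addn0 // s_lt // cA.
have f_inj : {in A &, injective f}.
  move=> y z yA zA E; have Ec : c y = c z.
    by apply: s_inj; rewrite ?cA // -!fmod // E.
  have := fdiv y yA; rewrite E fdiv // => Er.
  rewrite -(nth_index (u 0) (memr y yA)) -(nth_index (u 0) (memr z zA)).
  by rewrite -/(r y) -/(r z) -Er Ec.
have r0 y : y \in A -> (r y == 0) = (y == u (c y)).
  by move=> yA; rewrite /r /= [y == _]eq_sym; case: (u (c y) == y).
have f0 y : y \in A -> (f y == 0) = (y == u j).
  move=> yA; apply/idP/idP => [|/eqP->].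
    rewrite addn_eq0 muln_eq0 [a == 0]eqn0Ngt a0 orbF r0 // => /andP[/eqP Ey /eqP Es].
    rewrite Ey; apply/eqP; congr u; apply: s_inj; rewrite ?cA //.
    by rewrite Es sj.
  have [ujA cj] := uA j ja.
  by rewrite /f cj sj addn0 muln_eq0 r0 // cj eqxx.
have flt y : y \in A -> (f y < a) = (y == u (c y)).
  move=> yA; rewrite -(r0 y yA) -(fdiv y yA); apply/idP/idP => [lt|/eqP E].
    by rewrite divn_small.
  by rewrite (divn_eq (f y) a) E mul0n add0n ltn_mod.
exists f; split=> //.
  move=> y yA; rewrite cardA /f; have := r_lt y yA; have := szC _ (cA y yA).
  case: (boolP (big (c y))) => [bi|nbi]; last first.
    have := s_lt _ (cA y yA); move: nbi; rewrite /big => /eqP nb slt szc rlt.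
    have {}rlt : r y < q by lia.
    by apply: leq_trans (_ : (r y).+1 * a <= _); [rewrite mulSn; lia | rewrite mulnC; nia].
  have := s_big _ (cA y yA) bi; move: bi => /eqP -> slt _ rlt.
  by rewrite addnC mulnC -addSn leq_add // leq_mul2l -ltnS rlt orbT.
move=> y z yA zA; rewrite adjE // /tc_adj (inj_in_eq f_inj) // !lt0n !f0 // !flt // !fmod //.
have -> : (s (c y) == s (c z)) = (c y == c z).
  by apply/eqP/eqP => [|-> //]; apply: s_inj; rewrite cA.
case: (eqVneq y z) => //= nyz; case: (c y == c z) => //=.
case: (eqVneq y (u j)) => [Ey|nyj]; case: (eqVneq z (u j)) => [Ez|nzj] //=; rewrite ?andbF ?orbF //.
by case/eqP: nyz; rewrite Ey Ez.
Qed.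

End TuranConnected.

Section Hub.
Variables (T : finType) (e : rel T).
Hypotheses (sym : symmetric e) (irr : irreflexive e).
Implicit Types (A B S U W : {set T}) (v x y z : T) (c : T -> nat).

(** Equality in [turan_bound] makes [A :\ x] a balanced union of cliques. One clique lies inside the
    neighbourhood of [x], and connectedness gives a neighbour in each other clique. The count for
    [A :\: nbhd e x] leaves room for no further neighbour. *)
Lemma hub_tc_like A x a (m := #|A|.-1) : conn e A -> x \in A ->
    0 < a <= maxn m 1 -> alpha e A <= a ->
    nfib e (A :\ x) = turan_num m a ->
    nfib e (A :\: nbhd e x) = spoke_num m a ->
  tc_like e A a.
Proof.
move=> [_ connA] xA oka lea E1 E2; have /andP[a0 am] := oka.
pose B := A :\ x; pose q := m %/ a.
have cardA : #|A| = m.+1.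
  by rewrite /m prednK // card_gt0; apply/set0Pn; exists x.
have cardB : #|B| = m by move: cardA; rewrite (cardsD1 x) xA => -[].
have leaB : alpha e B <= a by apply: leq_trans lea; apply/leq_alpha/subD1set.
have clB : cluster e B by have [_] := turan_bound sym irr leaB; apply; rewrite cardB.
have [c colB] := cluster_has_coloring sym irr clB leaB.
have [c1 c2] := colB.
have bal i : i < a -> q <= #|color_class c B i| <= q.+1.
  by rewrite /q -cardB; apply: (turan_coloring_balanced sym irr colB); rewrite cardB.
have [|j ja subj] := coloring_full_class sym irr colB (negbT (setD11 _ _)); first by rewrite setD1K.
have inB y : y \in A -> y != x -> y \in B by move=> yA nyx; rewrite !inE nyx.
pose u i := if i == j then x else odflt x [pick y in color_class c B i | e x y].
have uj : u j = x by rewrite /u eqxx.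
have uP i : i < a -> i != j -> u i \in color_class c B i /\ e x (u i).
  move=> ia nij; rewrite /u (negPf nij); case: pickP => /= [y /andP[] //|H].
  have clsA : color_class c B i \subset A by apply/subsetP => y; rewrite !inE => /andP[/andP[_ ->]].
  have q0 : 0 < q.
    rewrite divn_gt0 //; suff : a != 1 by lia.
    by apply/eqP => a1; case/eqP: nij; lia.
  have cls0 : color_class c B i != set0 by rewrite -card_gt0; have := bal i ia; lia.
  have clsN : color_class c B i != A by apply: contraTneq xA => <-; rewrite !inE eqxx.
  (* Inside [B] the class has no edge to the rest, so an edge leaving it ends in [x]. *)
  have [y [z [yi /setDP[zA zi] eyz]]] := connA _ clsA cls0 clsN.
  have [Ezx|nzx] := eqVneq z x.
    by have := H y; rewrite yi /= sym -Ezx eyz.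
  have zB := inB z zA nzx; move: (yi); rewrite inE => /andP[yB /eqP Ey].
  by move: eyz; rewrite c2 // Ey => /andP[_ /eqP Ez]; rewrite inE zB -Ez eqxx in zi.
pose N := [set w in A | e x w].
pose S := [set u i | i : 'I_a & i != j :> nat].
have subN : color_class c B j :|: S \subset N.
  apply/subsetP => w /setUP[wj|/imsetP[i]].
    rewrite inE; have := subsetP subj w wj; rewrite inE => ->.
    by move: wj; rewrite !inE => /andP[/andP[_ ->]].
  rewrite inE => nij ->; have [] := uP i (ltn_ord i) nij.
  by rewrite !inE => /andP[/andP[_ ->] _] ->.
have cardS : #|S| = a.-1.
  rewrite card_in_imset; last first.
    move=> i k; rewrite !inE => nij nkj Eu; apply: val_inj => /=.
    have [] := uP i (ltn_ord i) nij; have [] := uP k (ltn_ord k) nkj.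
    by rewrite !inE -Eu => /andP[_ /eqP-> _] /andP[_ /eqP].
  rewrite -[a in RHS]card_ord -(cardC1 (Ordinal ja)).
  by apply: eq_card => i; rewrite !inE -val_eqE.
have disjS : [disjoint color_class c B j & S].
  rewrite disjoints_subset; apply/subsetP => w wj; rewrite inE; apply/negP => /imsetP[i].
  rewrite inE => nij Ew; have [ui _] := uP i (ltn_ord i) nij.
  by move: wj ui nij; rewrite !inE -Ew => /andP[_ /eqP->] /andP[_ /eqP->]; rewrite eqxx.
have cardN : deg e A x <= q + a.-1.
  have dm : deg e A x <= m by apply: deg_le.
  have := @turan_bound _ _ sym irr (A :\: nbhd e x) a.-1.
  rewrite card_setD_nbhd // E2 -/m leq_turan_num.
  have := alpha_setD_nbhd sym irr xA; rewrite -/q => lt [|leN _]; first by lia.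
  (* This lower bound shows that the subtractions from [m] in [leN] are not truncated. *)
  have : q + a.-1 <= deg e A x.
    apply: leq_trans (subset_leq_card subN); rewrite cardsU.
    have -> : color_class c B j :&: S = set0 by apply/eqP; rewrite setI_eq0.
    by rewrite cards0 subn0 cardS leq_add2r; have /andP[] := bal j ja.
  by lia.
have cardU : #|color_class c B j :|: S| = #|color_class c B j| + a.-1.
  have E : color_class c B j :&: S = set0 by apply/eqP; rewrite setI_eq0.
  by rewrite cardsU E cards0 subn0 cardS.
have szj : #|color_class c B j| = q.
  have := subset_leq_card subN; rewrite cardU -/(deg e A x).
  by have := bal j ja; lia.
have EN : N = color_class c B j :|: S.
  by apply/eqP; rewrite eq_sym eqEcard subN cardU szj.
have exE w : w \in B -> e x w = (c w == j) || (w == u (c w)).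
  move=> wB; have wA : w \in A by move: wB; rewrite inE => /andP[].
  have -> : e x w = (w \in N) by rewrite inE wA.
  rewrite EN 2!inE wB /=; case: eqVneq => //= ncj; apply/imsetP/eqP => [[i]|Ew].
    rewrite inE => nij Ew; have [] := uP i (ltn_ord i) nij.
    by rewrite -Ew inE => /andP[_ /eqP->].
  by exists (Ordinal (c1 w wB)); rewrite ?inE.
pose c' y := if y == x then j else c y.
have c'B y : y \in B -> c' y = c y by rewrite /c' !inE => /andP[/negPf-> _].
have c'x : c' x = j by rewrite /c' eqxx.
have cls_ne i : i != j -> color_class c' A i = color_class c B i.
  move=> nij; apply/setP => y; rewrite !inE /c'.
  by case: (eqVneq y x) => //= _; rewrite [j == i]eq_sym (negPf nij) andbF.
have cls_j : color_class c' A j = x |: color_class c B j.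
  by apply/setP => y; rewrite !inE /c'; case: (eqVneq y x) => //= ->; rewrite xA eqxx.
have szj' : #|color_class c' A j| = q.+1.
  by rewrite cls_j cardsU1 !inE eqxx szj.
apply: (@star_tc_like _ e A a c' u j q) => //.
- by move=> y yA; rewrite /c'; case: (eqVneq y x) => // nyx; apply: c1; apply: inB.
- move=> i ia; have [->|nij] := eqVneq i j; first by rewrite uj c'x.
  have [+ _] := uP i ia nij; rewrite inE => /andP[uB /eqP ci]; rewrite c'B //.
  by move: uB; rewrite inE => /andP[_ ->].
- move=> i ia; have [->|nij] := eqVneq i j; first by rewrite szj' leqnSn /=.
  by rewrite cls_ne // bal.
- rewrite (bigD1 (Ordinal ja)) //= szj' (eq_bigr (fun i : 'I_a => #|color_class c B i|)); last first.
    by move=> i; rewrite -val_eqE /= => /cls_ne->.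
  by rewrite cardA -cardB -(card_coloring colB) [in RHS](bigD1 (Ordinal ja)) //= szj addSn.
move=> y z yA zA; rewrite uj.
have [->|nyx] := eqVneq y x; have [->|nzx] := eqVneq z x.
- by rewrite irr.
- by rewrite c'x c'B ?inB // exE ?inB // [j == _]eq_sym orbF.
- by rewrite c'x c'B ?inB // sym exE ?inB // nyx.
by rewrite !c'B ?inB // c2 ?inB // orbF.
Qed.

End Hub.

(** * Connected graphs *)

Section Connected.
Variables (T : finType).
Implicit Types (e : rel T) (A B S U W : {set T}) (v x y z : T) (c : T -> nat).

Definition del_edge e x y : rel T :=
  fun u w => e u w && ~~ ((u == x) && (w == y) || (u == y) && (w == x)).
(** Each edge counts twice, over the whole type; this only serves as an induction measure. *)
Definition edges e := #|[set p : T * T | e p.1 p.2]|.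
Definition critical e A x y := alpha (del_edge e x y) A != alpha e A.

Lemma connVcut e B : B != set0 -> conn e B \/
  exists U, [/\ U \subset B, U != set0, U != B & {in U & B :\: U, forall x y, ~~ e x y}].
Proof.
move=> B0; case: (boolP [exists U : {set T}, [&& U \subset B, U != set0, U != B &
    [forall x in U, forall y in B :\: U, ~~ e x y]]]) => [/existsP[U /and4P[H1 H2 H3 /forall_inP H4]]|].
  by right; exists U; split=> // x y xU; move/forall_inP: (H4 x xU); apply.
rewrite negb_exists => /forallP H; left; split=> // U UB U0 UneB.
have := H U; rewrite UB U0 UneB /= negb_forall_in => /exists_inP[x xU].
by rewrite negb_forall_in => /exists_inP[y yU]; rewrite negbK => exy; exists x, y.
Qed.

Variable e : rel T.
Hypotheses (sym : symmetric e) (irr : irreflexive e).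

Lemma del_sym x y : symmetric (del_edge e x y).
Proof. by move=> u w; rewrite /del_edge sym orbC [(u == y) && _]andbC [(u == x) && _]andbC. Qed.

Lemma del_irr x y : irreflexive (del_edge e x y).
Proof. by move=> u; rewrite /del_edge irr. Qed.

Lemma edges_del x y : e x y -> edges (del_edge e x y) < edges e.
Proof.
move=> exy; apply/proper_card/properP; split.
  by apply/subsetP => p; rewrite !inE => /andP[].
by exists (x, y); rewrite !inE //= /del_edge !eqxx andbF.
Qed.

Lemma indep_del x y S : indep e S -> indep (del_edge e x y) S.
Proof. by move=> /indepP iS; apply/indepP => u w uS wS; rewrite negb_and iS. Qed.

(** The pair [[set x; y]] becomes stable. *)
Lemma nfib_del x y A : x \in A -> y \in A -> e x y -> nfib e A < nfib (del_edge e x y) A.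
Proof.
move=> xA yA exy; apply/proper_card/properP; split.
  by apply/subsetP => S; rewrite !inE => /andP[-> /indep_del->].
exists [set x; y]; rewrite !inE subUset !sub1set xA yA /=.
  by apply/indepP => u w /set2P[]-> /set2P[]->; rewrite /del_edge ?irr ?eqxx //= ?orbT andbF.
by apply/negP => /indepP/(_ x y); rewrite !inE !eqxx orbT exy => /(_ isT isT).
Qed.

(** A maximum stable set of the deleted graph is larger than [alpha e A]; without one of the ends it
    would be stable for [e]. *)
Lemma critical_set x y A : critical e A x y ->
  exists S, [/\ S \subset A, indep (del_edge e x y) S, alpha e A < #|S|, x \in S & y \in S].
Proof.
move=> cr; have [S [SA iS cS]] := alpha_ex (del_edge e x y) A.
have lt : alpha e A < #|S|.
  rewrite cS ltn_neqAle eq_sym; apply/andP; split=> //; apply/alpha_leP => S' S'A iS'.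
  by apply: alphaP => //; apply: indep_del.
exists S; split=> //; apply: contraTT lt; rewrite -leqNgt => nS; apply: alphaP => //;
  apply/indepP => u w uS wS; move/indepP: iS => /(_ u w uS wS);
  rewrite /del_edge negb_and negbK => /orP[//|/orP[]/andP[/eqP Eu /eqP Ew]];
  by rewrite -?Eu -?Ew ?uS ?wS in nS.
Qed.

(** Removing [x] from the set of [critical_set] leaves a large enough stable set of [e]. *)
Lemma critical_alpha x y A : critical e A x y -> alpha e (A :\ x) = alpha e A.
Proof.
move=> /critical_set[S [SA iS ltS xS yS]]; apply/eqP.
rewrite eqn_leq leq_alpha ?subD1set //=.
apply: leq_trans (_ : #|S :\ x| <= _); first by move: ltS; rewrite (cardsD1 x) xS.
apply: alphaP; first exact: setSD.
apply/indepP => u w /setD1P[nux uS] /setD1P[nwx wS].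
by move/indepP: iS => /(_ u w uS wS); rewrite /del_edge (negPf nux) (negPf nwx) andbF andbT.
Qed.

Lemma indep_delW x y B S : B \subset S -> indep (del_edge e x y) S ->
  (x \notin B) || (y \notin B) -> indep e B.
Proof.
move=> /subsetP BS /indepP iS H; apply/indepP => u w uB wB.
have := iS u w (BS u uB) (BS w wB); rewrite /del_edge negb_and negbK => /orP[//|].
by case/orP=> /andP[/eqP Eu /eqP Ew]; move: H; rewrite -Eu -Ew uB wB.
Qed.

(* Of two maximum sets for the deleted edges xy and xz, exchange the parts in U
   and W: the sizes of the two mixed sets add up to [2 * alpha + 1]. *)
Lemma critical_cut A U W x y z : x \in A -> A :\ x = U :|: W -> [disjoint U & W] ->
    {in U & W, forall u w, ~~ e u w} -> y \in W -> z \in U ->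
  critical e A x y -> ~~ critical e A x z.
Proof.
move=> xA EA dUW noUW yW zU /critical_set[S [SA iS ltS xS yS]]; apply/negP.
move=> /critical_set[R [RA iR ltR xR zR]].
have xU : x \notin U by apply/negP => xU; move/setP/(_ x): EA; rewrite !inE eqxx xU.
have xW : x \notin W by apply/negP => xW; move/setP/(_ x): EA; rewrite !inE eqxx xW orbT.
have [UA WA] : U \subset A /\ W \subset A.
  by apply/andP; rewrite -subUset -EA subD1set.
have split_card B : B \subset A -> x \in B -> #|B| = (#|B :&: U| + #|B :&: W|).+1.
  move=> BA xB; rewrite (cardsD1 x) xB add1n; congr _.+1.
  have -> : B :\ x = (B :&: U) :|: (B :&: W).
    apply/setP => u; rewrite -setIUr -EA !inE; case: (boolP (u \in B)) => [uB|_]; last by rewrite andbF.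
    by rewrite (subsetP BA) // !andbT.
  rewrite cardsU; have -> : B :&: U :&: (B :&: W) = set0.
    by apply/eqP; rewrite setI_eq0 (disjointWl (subsetIr _ _)) // (disjointWr (subsetIr _ _)).
  by rewrite cards0 subn0.
have yU : y \notin U by rewrite (disjointFl dUW yW).
have zW : z \notin W by rewrite (disjointFr dUW zU).
have nyx : x != y by apply: contraNneq xW => ->.
have nzx : x != z by apply: contraNneq xU => ->.
have noI (B C : {set T}) : {in B :&: U & C :&: W, forall u w, ~~ e u w}.
  by move=> u w /setIP[_ uU] /setIP[_ wW]; apply: noUW.
have dI (B C : {set T}) : B :&: U :&: (C :&: W) = set0.
  by apply/eqP; rewrite setI_eq0 (disjointWl (subsetIr _ _)) // (disjointWr (subsetIr _ _)).
(* This mixed set misses both [y] and [z], so [x] can be kept; the one in [le2] contains both and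
   drops [x]. *)
have le1 : (#|S :&: U| + #|R :&: W|).+1 <= alpha e A.
  have -> : (#|S :&: U| + #|R :&: W|).+1 = #|x |: ((S :&: U) :|: (R :&: W))|.
    by rewrite cardsU1 !inE (negPf xU) (negPf xW) !andbF add1n cardsU dI cards0 subn0.
  apply: alphaP.
    by rewrite !subUset sub1set xA (subset_trans (subsetIl _ _) SA) (subset_trans (subsetIl _ _) RA).
  have iU : indep e (x |: (S :&: U)).
    apply: (indep_delW (S := S) _ iS); first by rewrite subUset sub1set xS subsetIl.
    by rewrite !inE (negPf yU) andbF orbF [y == x]eq_sym nyx orbT.
  have iW : indep e (x |: (R :&: W)).
    apply: (indep_delW (S := R) _ iR); first by rewrite subUset sub1set xR subsetIl.
    by rewrite !inE (negPf zW) andbF orbF [z == x]eq_sym nzx orbT.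
  apply: indepU1 => //.
    by apply: indep_setU => //; [apply: indepS iU | apply: indepS iW]; apply: subsetUr.
  by move=> w /setUP[wI|wI]; [move/indepP: iU|move/indepP: iW]; apply; rewrite !inE ?eqxx //;
    move: wI; rewrite inE => ->; rewrite orbT.
have le2 : #|R :&: U| + #|S :&: W| <= alpha e A.
  have -> : #|R :&: U| + #|S :&: W| = #|(R :&: U) :|: (S :&: W)|.
    by rewrite cardsU dI cards0 subn0.
  apply: alphaP.
    by rewrite subUset (subset_trans (subsetIl _ _) SA) (subset_trans (subsetIl _ _) RA).
  apply: indep_setU => //.
    by apply: (indep_delW (subsetIl _ _) iR); rewrite inE (negPf xU) andbF.
  by apply: (indep_delW (subsetIl _ _) iS); rewrite inE (negPf xW) andbF.
rewrite (split_card S) // in ltS; rewrite (split_card R) // in ltR.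
by clear -ltS ltR le1 le2; lia.
Qed.

(** If all of [A] is stable, connectedness leaves a single vertex, the case covered by [maxn]. *)
Lemma conn_alpha A : conn e A -> 0 < alpha e A <= maxn #|A|.-1 1.
Proof.
case=> /set0Pn[v vA] cA; apply/andP; split.
  rewrite -(cards1 v); apply: alphaP; rewrite ?sub1set //.
  by apply/indepP => x y /set1P-> /set1P->; rewrite irr.
have [S [SA iS <-]] := alpha_ex e A.
have [E|neS] := eqVneq S A; last first.
  have : #|S| < #|A| by apply: proper_card; rewrite properEneq neS SA.
  by lia.
have [EA|ne] := eqVneq A [set v]; first by rewrite E EA cards1.
have [|||x [y [/set1P-> /setDP[yA _] evy]]] := cA [set v]; rewrite ?sub1set //.
- by apply/set0Pn; exists v; rewrite inE.
- by rewrite eq_sym.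
by move/indepP: iS => /(_ v y); rewrite E vA yA evy => /(_ isT isT).
Qed.

Lemma alpha_setU U W : [disjoint U & W] -> {in U & W, forall x y, ~~ e x y} ->
  alpha e (U :|: W) = alpha e U + alpha e W.
Proof.
move=> dUW noUW; apply/eqP; rewrite eqn_leq; apply/andP; split.
  have [S [SA iS <-]] := alpha_ex e (U :|: W).
  have -> : #|S| = #|S :&: U| + #|S :&: W|.
    have {1}-> : S = (S :&: U) :|: (S :&: W) by rewrite -setIUr; apply/esym/setIidPl.
    rewrite cardsU; have -> : S :&: U :&: (S :&: W) = set0.
      by apply/eqP; rewrite setI_eq0 (disjointWl (subsetIr _ _)) // (disjointWr (subsetIr _ _)).
    by rewrite cards0 subn0.
  by rewrite leq_add // alphaP ?subsetIr // (indepS (subsetIl _ _)).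
have [R [RU iR <-]] := alpha_ex e U; have [S [SW iS <-]] := alpha_ex e W.
have -> : #|R| + #|S| = #|R :|: S|.
  rewrite cardsU; have -> : R :&: S = set0.
    by apply/eqP; rewrite setI_eq0 (disjointWl RU) // (disjointWr SW).
  by rewrite cards0 subn0.
apply: alphaP; first exact: setUSS.
apply: indep_setU => // x y xR yS; apply: noUW; by [apply: (subsetP RU)|apply: (subsetP SW)].
Qed.

(** An edge leaving a part of [U] that misses [x] cannot leave [U]. A part containing [x] is handled
    through its complement in [U]. *)
Lemma conn_side A U x y : conn e A -> U \subset A -> x \in U ->
    {in U & A :\: U, forall p q, e p q -> p = x /\ q = y} -> conn e U.
Proof.
move=> [_ cA] UA xU cross; split=> [|Z ZU Z0 ZneU]; first by apply/set0Pn; exists x.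
have key (Y : {set T}) : Y \subset U -> Y != set0 -> x \notin Y ->
    exists p q, [/\ p \in Y, q \in U :\: Y & e p q].
  move=> YU Y0 xY; have [|||p [q [pY /setDP[qA qY] epq]]] := cA Y.
  - exact: subset_trans UA.
  - exact: Y0.
  - by apply: contraNneq xY => ->; apply: (subsetP UA).
  exists p, q; split=> //; rewrite inE qY; case: (boolP (q \in U)) => //= qU.
  have [||Ep _] := cross p q _ _ epq; rewrite ?inE ?qU ?(subsetP YU) //.
  by rewrite -Ep pY in xY.
case: (boolP (x \in Z)) => [xZ|]; last exact: key.
have [||p [q [/setDP[pU pZ] qUZ epq]]] := key (U :\: Z) (subsetDl _ _).
- by rewrite setD_eq0; apply: contra ZneU => UZ; rewrite eqEsubset ZU.
- by rewrite inE xZ.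
exists q, p; rewrite sym inE pU pZ; split=> //.
by move: qUZ; rewrite !inE; case: (q \in Z); rewrite //= andNb.
Qed.

(** The only edge between [U] and its complement is xy; whichever of the two contains [x] is
    taken. *)
Lemma bridge_split A U x y : conn e A -> x \in A -> y \in A -> e x y ->
    U \subset A -> U != set0 -> U != A -> {in U & A :\: U, forall p q, ~~ del_edge e x y p q} ->
  exists V : {set T}, [/\ V \subset A, x \in V, y \in A :\: V
    & {in V & A :\: V, forall p q, e p q -> p = x /\ q = y}].
Proof.
move=> [A0 cA] xA yA exy UA U0 UneA noU.
have cross p q : p \in U -> q \in A :\: U -> e p q -> (p = x /\ q = y) \/ (p = y /\ q = x).
  move=> pU qU epq; have := noU p q pU qU.
  by rewrite /del_edge epq /= negbK => /orP[]/andP[/eqP-> /eqP->]; [left|right].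
have [p [q [pU qU epq]]] := cA U UA U0 UneA.
have [[Ep Eq]|[Ep Eq]] := cross p q pU qU epq; subst p q.
  exists U; split=> // p q pU' qU' /(cross _ _ pU' qU')[//|[Ep _]].
  by move: qU; rewrite -Ep inE pU'.
have EU : A :\: (A :\: U) = U by rewrite setDDr setDv set0U; apply/setIidPr.
exists (A :\: U); rewrite EU subsetDl; split=> // p q pU' qU'.
rewrite sym => /(cross _ _ qU' pU')[[Eq _]|[-> ->] //].
by move: qU; rewrite -Eq inE qU'.
Qed.

End Connected.

(** * Bridges, and the appearance of the five-cycle *)

Definition c5_adj i j := (i != j) && ((j == i.+1 %% 5) || (i == j.+1 %% 5)).

Section Extremal.
Variables (T : finType).
Implicit Types (e : rel T) (A B S U W : {set T}) (v x y z : T) (c : T -> nat).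

Definition c5_like e A := exists f : T -> nat,
  [/\ {in A &, injective f}, {in A, forall x, f x < 5}
    & {in A &, forall x y, e x y = c5_adj (f x) (f y)}].

Definition extremal e A a := tc_like e A a \/ [/\ #|A| = 5, a = 2 & c5_like e A].

Variable e : rel T.
Hypotheses (sym : symmetric e) (irr : irreflexive e).

(** The stable sets of [A] are counted by those of [U] and [W] according to the ends of the bridge.
    [leq_bridge_num] then bounds the count, and its two equality cases are [hub_tc_like] at [x] and
    at [y]. *)
Lemma bridge_bound A U x y (W := A :\: U) : conn e A -> U \subset A ->
    x \in U -> y \in W -> e x y ->
    {in U & W, forall p q, e p q -> p = x /\ q = y} ->
    alpha e A = alpha e U + alpha e W ->
    nfib e U <= tc_num #|U| (alpha e U) -> nfib e W <= tc_num #|W| (alpha e W) ->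
  nfib e A <= tc_num #|A| (alpha e A) /\
  (nfib e A = tc_num #|A| (alpha e A) -> tc_like e A (alpha e A)).
Proof.
move=> connA UA xU yW exy cross Ealpha leU leW.
have WA : W \subset A by apply: subsetDl.
have AW : A :\: W = U by rewrite setDDr setDv set0U; apply/setIidPr.
have crossW : {in W & U, forall p q, e p q -> p = y /\ q = x}.
  by move=> p q pW qU; rewrite sym => epq; have [-> ->] := cross q p qU pW epq.
have connU : conn e U by apply: (conn_side sym connA UA xU cross).
have connW : conn e W.
  by apply: (conn_side (y := x) sym connA WA yW); rewrite AW.
have dUW : [disjoint U & W] by rewrite disjoint_subset; apply/subsetP => z zU; rewrite !inE zU.
have EA : A = U :|: W by rewrite -[LHS](setID A U) (setIidPr UA).
have [xA yA] := (subsetP UA x xU, subsetP WA y yW).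
have part B1 B2 : B1 \subset U -> B2 \subset W -> (x \notin B1) || (y \notin B2) ->
    nfib e (B1 :|: B2) = nfib e B1 * nfib e B2.
  move=> s1 s2 nxy; apply: nfib_setU => //; first exact: disjointW dUW.
  move=> p q p1 q2; apply: contraL nxy => epq.
  have [Ep Eq] := cross p q (subsetP s1 p p1) (subsetP s2 q q2) epq.
  by rewrite -Ep -Eq p1 q2.
have xW : x \notin W by rewrite (disjointFr dUW xU).
have yU : y \notin U by rewrite (disjointFl dUW yW).
(* Used for both ends of the bridge: the closed neighbourhood of [p] meets the other side only in
   [q]. *)
have sideN P p Q q : P :|: Q = A -> [disjoint P & Q] -> p \in P -> q \in Q -> e p q ->
    {in P & Q, forall p' q', e p' q' -> p' = p /\ q' = q} ->
    (A :\ p = (P :\ p) :|: Q) /\ (A :\: nbhd e p = (P :\: nbhd e p) :|: (Q :\ q)).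
  move=> <- dPQ pP qQ epq crPQ; rewrite !setDUl; split; congr (_ :|: _).
    by apply/setDidPl; rewrite disjoint_sym disjoints1 (disjointFr dPQ pP).
  apply/setP => w; rewrite !inE; case: (boolP (w \in Q)) => wQ; rewrite ?andbF // !andbT negb_or.
  have -> /= : w != p by apply: contraTneq wQ => ->; rewrite (disjointFr dPQ pP).
  by congr negb; apply/idP/eqP => [/(crPQ p w pP wQ)[]|->].
have [Ax AxN] := sideN U x W y (esym EA) dUW xU yW exy cross.
have [Ay AyN] : A :\ y = (W :\ y) :|: U /\ A :\: nbhd e y = (W :\: nbhd e y) :|: (U :\ x).
  by apply: sideN; rewrite // ?[e y x]sym // 1?setUC // disjoint_sym.
rewrite setUC in Ay; rewrite setUC in AyN.
have F1 : nfib e (A :\ x) = nfib e (U :\ x) * nfib e W.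
  by rewrite Ax part ?subD1set // !inE eqxx.
have F2 : nfib e (A :\: nbhd e x) = nfib e (U :\: nbhd e x) * nfib e (W :\ y).
  by rewrite AxN part ?subD1set ?subsetDl // !inE eqxx.
have F3 : nfib e (A :\ y) = nfib e U * nfib e (W :\ y).
  by rewrite Ay part ?subD1set // [y \in W :\ y]inE !inE eqxx orbT.
have F4 : nfib e (A :\: nbhd e y) = nfib e (U :\ x) * nfib e (W :\: nbhd e y).
  by rewrite AyN part ?subD1set ?subsetDl // !inE eqxx.
have okU := conn_alpha irr connU; have okW := conn_alpha irr connW.
have EFU := nfib_rec sym irr xU; have EFW := nfib_rec sym irr yW.
have cardU : #|U| = #|U|.-1.+1 by rewrite prednK // card_gt0; apply/set0Pn; exists x.
have cardW : #|W| = #|W|.-1.+1 by rewrite prednK // card_gt0; apply/set0Pn; exists y.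
have cardA : #|A|.-1 = (#|U|.-1 + #|W|.-1).+1.
  rewrite EA cardsU; have /eqP-> : U :&: W == set0 by rewrite setI_eq0.
  by rewrite cards0 subn0; clear -cardU cardW; lia.
have leUx : nfib e (U :\ x) <= turan_num #|U|.-1 (alpha e U).
  have [+ _] := turan_bound sym irr (leq_alpha e (subD1set U x)).
  by have -> : #|U :\ x| = #|U|.-1 by rewrite [#|U|](cardsD1 x) xU.
have leWy : nfib e (W :\ y) <= turan_num #|W|.-1 (alpha e W).
  have [+ _] := turan_bound sym irr (leq_alpha e (subD1set W y)).
  by have -> : #|W :\ y| = #|W|.-1 by rewrite [#|W|](cardsD1 y) yW.
rewrite EFU in leU; rewrite EFW in leW.
have FA : nfib e A = nfib e (U :\ x) * nfib e (W :\ y)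
    + nfib e (U :\ x) * nfib e (W :\: nbhd e y) + nfib e (U :\: nbhd e x) * nfib e (W :\ y).
  by rewrite (nfib_rec sym irr xA) F1 F2 EFW mulnDr.
have okA := conn_alpha irr connA.
suff [H1 H2] : nfib e A <= tc_num #|A| (alpha e A) /\
    (nfib e A = tc_num #|A| (alpha e A) ->
     nfib e (A :\ x) = turan_num #|A|.-1 (alpha e A) /\
     nfib e (A :\: nbhd e x) = spoke_num #|A|.-1 (alpha e A) \/
     nfib e (A :\ y) = turan_num #|A|.-1 (alpha e A) /\
     nfib e (A :\: nbhd e y) = spoke_num #|A|.-1 (alpha e A)).
  split=> // /H2[[E1 E2]|[E1 E2]].
    exact: (hub_tc_like sym irr connA xA okA (leqnn _) E1 E2).
  exact: (hub_tc_like sym irr connA yA okA (leqnn _) E1 E2).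
rewrite F1 F2 F3 F4 FA /tc_num cardA Ealpha EFU EFW.
(* [leq_bridge_num] takes the larger quotient first; in the second case [U] and [W] exchange
   roles. *)
case: (leqP (#|W|.-1 %/ alpha e W) (#|U|.-1 %/ alpha e U)) => [le|/ltnW le].
  have [B1 B2] := leq_bridge_num okU okW le leUx leU leWy leW (nfib_gt0 _ _) (nfib_gt0 _ _).
  split=> // /B2[[-> ->]|[<- <-]]; first by left.
  by right; rewrite mulnC; split=> //; rewrite mulnC.
have [] := leq_bridge_num okW okU le leWy leW leUx leU (nfib_gt0 _ _) (nfib_gt0 _ _).
set s := _ + _ * nfib e (W :\ y); set s' := _ + _ * nfib e (U :\ x).
have -> : s' = s by rewrite /s /s'; ring.
rewrite [alpha e W + _]addnC [#|W|.-1 + _]addnC => B1 B2; split=> // /B2[[<- <-]|[-> ->]].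
  by right; rewrite mulnC; split=> //; rewrite mulnC.
by left; split.
Qed.

(** The hub has degree [d + a - 2] in [A :\ v], so [a = 2] and [v] misses the hub; the end of the
    spoke is saturated too. All other vertices are adjacent to [v], as otherwise a stable set of
    size 3 arises. So [2 * d - 2 <= d], and [d = 2]. *)
Lemma tc_like_cone A v a d : v \in A -> tc_like e (A :\ v) a -> #|A :\ v| = d * a ->
    1 < a -> 1 < d -> {in A, forall w, deg e A w <= d} -> alpha e A <= a ->
  [/\ #|A| = 5, a = 2 & c5_like e A].
Proof.
move=> vA [f [f_inj f_lt adjE]] cardB a1 d1 degd lea.
set B := A :\ v in f_inj f_lt adjE cardB; rewrite cardB in f_lt.
have [a0 d0] : 0 < a /\ 0 < d by split; apply: ltnW.
have BA z : z \in B -> z \in A by rewrite inE => /andP[].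
have Bv z : z \in B -> z != v by rewrite !inE => /andP[].
(* [g] inverts [f], which reaches every label below [d * a] by counting. *)
have [g gP] : exists g : nat -> T, forall k, k < d * a -> g k \in B /\ f (g k) = k.
  exists (fun k => odflt v [pick z in B | f z == k]) => k ltk.
  case: pickP => [z /andP[zB /eqP] //|H].
  have [|||_ Em] := @uniq_min_size _ (map f (enum B)) (iota 0 (d * a)).
  - by rewrite map_inj_in_uniq ?enum_uniq // => y z; rewrite !mem_enum; apply: f_inj.
  - by move=> _ /mapP[z + ->]; rewrite mem_enum mem_iota => /f_lt.
  - by rewrite size_map size_iota -cardE cardB.
  have := Em k; rewrite mem_iota ltk => /mapP[z]; rewrite mem_enum => zB Ek.
  by have := H z; rewrite zB Ek eqxx.
have degB y ks : y \in B -> uniq ks ->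
    {in ks, forall k, k < d * a /\ e y (g k)} -> size ks + e y v <= d.
  move=> yB uks H; apply: leq_trans (degd y (BA y yB)).
  pose s := nseq (e y v) v ++ map g ks.
  have us : uniq s.
    rewrite cat_uniq map_inj_in_uniq ?uks => [|k l /H[ltk _] /H[ltl _] E]; last first.
      by have [_ <-] := gP k ltk; have [_ <-] := gP l ltl; rewrite E.
    rewrite andbT; case: (e y v) => //=; last by apply/hasPn.
    apply/hasPn => _ /mapP[k /H[ltk _] ->]; have [gB _] := gP k ltk.
    by rewrite inE; apply: Bv.
  have -> : size ks + e y v = #|s|.
    by rewrite (card_uniqP us) size_cat size_nseq size_map addnC.
  apply/subset_leq_card/subsetP => z; rewrite mem_cat mem_nseq inE.
  case/orP=> [/andP[eyv /eqP->]|/mapP[k /H[ltk eyk] ->]].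
    by rewrite vA; case: (e y v) eyv.
  by have [/BA-> _] := gP k ltk.
have da : 1 < d * a by apply: leq_trans (leq_pmulr _ _) => //; apply: ltnW.
have [x0B f0] := gP 0 (ltnW da); have [x1B f1] := gP 1 da.
have a2 : a = 2 /\ e (g 0) v = false.
  (* The neighbours of the hub: the ends of the spokes, then the rest of its clique. *)
  pose ks := iota 1 a.-1 ++ map (muln a) (iota 1 d.-1).
  have : size ks + e (g 0) v <= d.
    apply: degB => //.
      rewrite cat_uniq iota_uniq map_inj_uniq ?iota_uniq => [|k l /eqP]; last first.
        by rewrite eqn_pmul2l ?a0 // => /eqP.
      rewrite andbT; apply/hasPn => _ /mapP[k + ->]; rewrite !mem_iota.
      by rewrite add1n prednK ?a0 //; case: k => // k _; rewrite mulnS; lia.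
    move=> k; rewrite mem_cat => /orP[|/mapP[l + ->]]; rewrite mem_iota add1n prednK ?a0 ?d0 //.
      move=> /andP[k0 ka]; have ltk : k < d * a by apply: leq_trans ka (leq_pmull _ d0).
      have [gB fg] := gP k ltk; split=> //; rewrite adjE // f0 fg /tc_adj k0 ka /= orbT andbT.
      by rewrite eq_sym -lt0n.
    move=> /andP[l0 ld]; have ltk : a * l < d * a by rewrite mulnC ltn_pmul2r.
    have [gB fg] := gP _ ltk; split=> //; rewrite adjE // f0 fg /tc_adj mod0n modnMr eqxx /= andbT.
    by rewrite eq_sym muln_eq0 negb_or -!lt0n l0 a0.
  by rewrite size_cat size_map !size_iota; case: (e (g 0) v) => /=; clear -a1 d1; lia.
case: a2 => a2 e0v; subst a.
have e1v : e (g 1) v = false.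
  (* The neighbours of the end of the spoke: the hub, then the other odd labels. *)
  pose ks := 0 :: map (fun j => j * 2 + 1) (iota 1 d.-1).
  have : size ks + e (g 1) v <= d.
    apply: degB => //.
      rewrite cons_uniq map_inj_uniq ?iota_uniq ?andbT => [|k l]; last by lia.
      by apply/mapP => -[k _]; lia.
    move=> k; rewrite inE => /orP[/eqP->|/mapP[l + ->]].
      by split; [lia | rewrite adjE // f1 f0].
    rewrite mem_iota => /andP[l0 ld]; have ltk : l * 2 + 1 < d * 2 by lia.
    have [gB fg] := gP _ ltk; split=> //; rewrite adjE // f1 fg /tc_adj modnMDl eqxx andbT.
    by lia.
  by rewrite /= size_map size_iota; case: (e (g 1) v) => //=; clear -d1; lia.
(* [z] lies in the clique opposite to [g i] and is not an end of the spoke, so [v], [g i] and [z]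
   would be stable. *)
have indep3 i z : (i < 2) -> z \in B -> f z = i.+1 %[mod 2] -> 1 < f z -> e v z.
  move=> i2 zB fz z1; apply: contraTT lea => Nevz; rewrite -ltnNge.
  have lti : i < d * 2 by apply: leq_trans i2 _; rewrite leq_pmull.
  have [giB fi] := gP i lti.
  have Neiz : e (g i) z = false.
    by rewrite adjE // fi /tc_adj; apply/negbTE; clear -i2 fz z1; lia.
  have Neiv : e (g i) v = false by case: i i2 {lti fz giB fi Neiz} => [|[|]].
  have niz : g i != z.
    by apply: contraTneq z1 => <-; rewrite fi -leqNgt.
  have -> : 3 = #|[set v; g i; z]|.
    by rewrite -setUA cardsU1 cards2 !inE niz ![v == _]eq_sym (negPf (Bv _ giB)) (negPf (Bv _ zB)).
  apply: alphaP.
    by rewrite !subUset !sub1set vA !BA.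
  by apply/indepP => p q; rewrite !inE -!orbA => /or3P[]/eqP-> /or3P[]/eqP->;
    rewrite ?irr // ?[e v (g i)]sym ?[e z (g i)]sym ?[e z v]sym ?Neiz ?Neiv.
have evz z : z \in B -> e v z = (1 < f z).
  move=> zB; apply/idP/idP => [evz|z1]; last first.
    have [o|o] := boolP (odd (f z)); [apply: (indep3 0) | apply: (indep3 1)] => //.
      by rewrite modn2 o.
    by rewrite modn2 (negPf o).
  have z01 i : i < 2 -> f z = i -> z = g i.
    move=> i2 fz; apply: f_inj => //; have [] := gP i; rewrite ?fz //; by lia.
  rewrite ltnNge; apply: contraL evz; rewrite sym leq_eqVlt ltnS leqn0.
  by case/orP=> /eqP fz; [rewrite (z01 1) ?e1v | rewrite (z01 0) ?e0v].
have d2 : d = 2.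
  have : size (iota 2 (2 * d - 2)) <= d; last by rewrite size_iota; clear -d1; lia.
  apply: leq_trans (degd v vA); rewrite -(size_map g).
  have us : uniq (map g (iota 2 (2 * d - 2))).
    rewrite map_inj_in_uniq ?iota_uniq // => k l; rewrite !mem_iota => Hk Hl E.
    by have [|_ <-] := gP k; [lia|have [|_ <-] := gP l; [lia|rewrite E]].
  rewrite -(card_uniqP us); apply/subset_leq_card/subsetP => _ /mapP[k + ->].
  rewrite mem_iota => Hk; have [|gB fg] := gP k; first by lia.
  by rewrite inE BA //= evz // fg; lia.
subst d; split=> //; first by rewrite (cardsD1 v) vA cardB.
have f4 z : z \in B -> f z < 4 by move=> /f_lt.
have inB z : z \in A -> z != v -> z \in B by move=> zA nzv; rewrite !inE nzv.
(* The cycle runs through [v] and the labels 2, 0, 1, 3 in this order. *)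
pose h z := if z == v then 0 else nth 0 [:: 2; 3; 1; 4] (f z).
have hv : h v = 0 by rewrite /h eqxx.
have hB z : z \in B -> h z = nth 0 [:: 2; 3; 1; 4] (f z) by move=> /Bv/negPf nzv; rewrite /h nzv.
exists h; split.
- move=> y z yA zA; have [->|nyv] := eqVneq y v; have [->|nzv] := eqVneq z v => //.
  + by rewrite hv hB ?inB //; have := f4 _ (inB z zA nzv); move: (f z) => [|[|[|[|]]]].
  + by rewrite hv hB ?inB //; have := f4 _ (inB y yA nyv); move: (f y) => [|[|[|[|]]]].
  rewrite !hB ?inB // => E; apply: f_inj; rewrite ?inB //.
  have := f4 _ (inB z zA nzv); have := f4 _ (inB y yA nyv); move: E.
  by move: (f y) (f z) => [|[|[|[|?]]]] [|[|[|[|?]]]].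
- move=> z zA; have [->|nzv] := eqVneq z v; first by rewrite hv.
  by rewrite hB ?inB //; have := f4 _ (inB z zA nzv); move: (f z) => [|[|[|[|?]]]].
move=> y z yA zA; have [->|nyv] := eqVneq y v; have [->|nzv] := eqVneq z v.
- by rewrite irr hv.
- by rewrite hv hB ?evz ?inB //; have := f4 _ (inB z zA nzv); move: (f z) => [|[|[|[|?]]]].
- by rewrite hv hB ?[e y v]sym ?evz ?inB //; have := f4 _ (inB y yA nyv); move: (f y) => [|[|[|[|?]]]].
rewrite !hB ?adjE ?inB //; have := f4 _ (inB z zA nzv); have := f4 _ (inB y yA nyv).
by move: (f y) (f z) => [|[|[|[|?]]]] [|[|[|[|?]]]].
Qed.

End Extremal.

(** * The induction for connected graphs *)

Section Main.
Variables (T : finType).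
Implicit Types (e : rel T) (A B S U W : {set T}) (v x y z : T).

(** With [#|A| = p + 2], [conn_card_le] gives [p %/ a < d]. The bounds for [B] and for
    [A :\: nbhd e v] then sum to at most [turan_num p.+1 a + spoke_num p a]. Equality makes every
    estimate tight. *)
Lemma tight_bound e A v a (B := A :\ v) : symmetric e -> irreflexive e ->
    conn e A -> v \in A -> {in A, forall w, deg e A w <= deg e A v} ->
    conn e B -> alpha e A = a -> alpha e B = a ->
    nfib e B <= tc_num #|B| a -> (nfib e B = tc_num #|B| a -> extremal e B a) ->
  nfib e A <= tc_num #|A| a /\ (nfib e A = tc_num #|A| a -> extremal e A a).
Proof.
move=> sym irr connA vA maxv connB EaA EaB leB eqB.
have okA := conn_alpha irr connA; have okB := conn_alpha irr connB.
have degA := conn_card_le sym irr connA maxv.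
have ltN := alpha_setD_nbhd sym irr vA.
rewrite EaA in okA degA ltN; rewrite EaB in okB.
have [a0 _] := andP okA.
have [p Ep] : exists p, #|B| = p.+1.
  by exists #|B|.-1; rewrite prednK // card_gt0; case: connB.
have cardA : #|A| = p.+2 by rewrite (cardsD1 v) vA -/B Ep.
set d := deg e A v in maxv degA; rewrite cardA ltnS in degA.
have dm : d <= p.+1 by have := deg_le irr vA; rewrite cardA.
have ltd : p %/ a < d by rewrite ltn_divLR // mulnC.
have [leN _] : nfib e (A :\: nbhd e v) <= turan_num (p.+1 - d) a.-1 /\
    (nfib e (A :\: nbhd e v) = turan_num (p.+1 - d) a.-1 -> cluster e (A :\: nbhd e v)).
  have := @turan_bound _ _ sym irr (A :\: nbhd e v) a.-1.
  by rewrite card_setD_nbhd // cardA; apply; rewrite -ltnS prednK.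
have leN' : turan_num (p.+1 - d) a.-1 <= turan_num (p - p %/ a) a.-1.
  by rewrite leq_turan_num; clear -ltd; lia.
have divS : p.+1 %/ a <= (p %/ a).+1.
  by rewrite divnS // -[X in _ <= X]add1n leq_add2r leq_b1.
have leS : spoke_num p a <= spoke_num p.+1 a.
  by rewrite leq_turan_num; clear -divS; lia.
rewrite Ep in leB eqB; rewrite /tc_num /= in leB eqB.
have EA := nfib_rec sym irr vA; rewrite -/B in EA.
have ET := turan_numS p a0.
rewrite cardA /tc_num /= EA ET; split; first by clear -leB leN leN' leS; lia.
move=> E.
have E1 : nfib e B = turan_num p a + spoke_num p a by clear -E leB leN leN' leS; lia.
have E2 : turan_num (p.+1 - d) a.-1 = turan_num (p - p %/ a) a.-1.
  by clear -E leB leN leN' leS; lia.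
have E3 : spoke_num p a = spoke_num p.+1 a by clear -E leB leN leN' leS; lia.
have E4 : nfib e (A :\: nbhd e v) = turan_num (p.+1 - d) a.-1 by clear -E leB leN leN' leS; lia.
move/eq_turan_num in E2; move/eq_turan_num in E3.
(* For [a = 1] every [spoke_num] is 1, and [v] itself satisfies the conditions on a hub. *)
have [Ea1|a1] := eqVneq a 1.
  left; apply: (hub_tc_like sym irr connA vA okA); rewrite ?EaA // cardA /= -/B.
    rewrite E1 Ea1 !turan_num1r /spoke_num divn1 subnn turan_num0l.
    by rewrite addn1.
  by rewrite E4 E2 Ea1 /spoke_num /= !divn1 !subnn.
have {}a1 : 1 < a by clear -a0 a1; lia.
have lap : a <= p by move: okB; rewrite Ep /=; clear -a1; lia.
have q0 : 0 < p %/ a by rewrite divn_gt0.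
have Ed : d = (p %/ a).+1.
  by have := leq_div p a; clear -ltd dm E2; lia.
(* Otherwise [p] and [p.+1] have the same quotient by [a], and [spoke_num] would grow strictly. *)
have dvd : a %| p.+1.
  apply: contraT => ndvd; move: E3; rewrite divnS // (negPf ndvd) add0n.
  have : p %/ a + a.-1 <= p.
    apply: leq_trans (leq_divM p a); clear -q0 a1.
    by case: (p %/ a) q0 => // k _; case: a a1 => // b _; rewrite mulSn mulnS /=; lia.
  by clear; lia.
have Ep1 : #|B| = d * a.
  by rewrite Ep -(divnK dvd) divnS // dvd add1n Ed.
have d1 : 1 < d by rewrite Ed ltnS.
(* [B] cannot be C_5, since [a = 2] does not divide 5. *)
right; have [tcB|[B5 a2 _]] := eqB E1.
  by apply: (tc_like_cone sym irr vA tcB Ep1) => //; rewrite EaA.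
by move: dvd; rewrite -Ep B5 a2.
Qed.

(** The measure drops both when an edge is deleted on the same [A] and when [A] shrinks. *)
Lemma conn_bound e A : symmetric e -> irreflexive e -> conn e A ->
  nfib e A <= tc_num #|A| (alpha e A) /\
  (nfib e A = tc_num #|A| (alpha e A) -> extremal e A (alpha e A)).
Proof.
have [k] := ubnP (#|A| + edges e); elim: k e A => // k IH e A ltk sym irr connA.
have [A0 cA] := connA.
have okA := conn_alpha irr connA.
have [v vA maxv] := max_deg e A0.
have cardA : #|A| = #|A :\ v|.+1 by rewrite (cardsD1 v) vA.
have [B0|B0] := eqVneq (A :\ v) set0.
  rewrite B0 cards0 in cardA.
  have Ea : alpha e A = 1 by move: okA; rewrite cardA /=; clear; lia.
  have F1 : nfib e (A :\ v) = 1 by rewrite B0 nfib0.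
  have F2 : nfib e (A :\: nbhd e v) = 1.
    suff -> : A :\: nbhd e v = set0 by rewrite nfib0.
    apply/eqP; rewrite -subset0 -B0; apply: setDS.
    by rewrite sub1set inE eqxx.
  rewrite (nfib_rec sym irr vA) F1 F2 cardA Ea; split=> // _; left.
  by apply: (hub_tc_like sym irr connA vA); rewrite ?cardA ?Ea ?F1 ?F2.
have [|] := boolP [exists x in A, exists y in A, e x y && ~~ critical e A x y].
  move=> /exists_inP[x xA /exists_inP[y yA /andP[exy]]]; rewrite negbK => /eqP Ea.
  have sym' := del_sym sym x y; have irr' := del_irr irr x y.
  have [connA'|[U0 [U0A U00 U0neA noU]]] := connVcut (del_edge e x y) A0.
    have [|le _] := IH _ A _ sym' irr' connA'.
      by have := edges_del exy; clear -ltk; lia.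
    have lt := nfib_del irr xA yA exy.
    rewrite Ea in le; have {}lt := leq_trans lt le.
    by split; [apply: ltnW | move=> E; rewrite E ltnn in lt].
  have [U [UA xU yW cross]] := bridge_split sym connA xA yA exy U0A U00 U0neA noU.
  have WA : A :\: U \subset A by apply: subsetDl.
  have AW : A :\: (A :\: U) = U by rewrite setDDr setDv set0U; apply/setIidPr.
  have crossW : {in A :\: U & U, forall p q, e p q -> p = y /\ q = x}.
    by move=> p q pW qU; rewrite sym => epq; have [-> ->] := cross q p qU pW epq.
  have connU : conn e U by apply: (conn_side sym connA UA xU cross).
  have connW : conn e (A :\: U).
    by apply: (conn_side (y := x) sym connA WA yW); rewrite AW.
  have yU : y \notin U by move: yW; rewrite inE => /andP[].
  have ltc (V : {set T}) w : V \subset A -> w \in A -> w \notin V -> #|V| + edges e < k.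
    move=> VA wA wV; apply: leq_trans (_ : #|A| + edges e <= k); last by rewrite -ltnS.
    by rewrite ltn_add2r; apply/proper_card/properP; split=> //; exists w.
  have sumA : alpha e A = alpha e U + alpha e (A :\: U).
    rewrite -Ea.
    rewrite -[in LHS](setID A U) (setIidPr UA) alpha_setU //.
    - congr (_ + _); apply: eq_alpha => p q pV qV; rewrite /del_edge.
        have [Ep|_] := eqVneq p y; first by rewrite Ep (negPf yU) in pV.
        have [Eq|_] := eqVneq q y; first by rewrite Eq (negPf yU) in qV.
        by rewrite andbF andbT.
      have [Ep|_] := eqVneq p x; first by rewrite Ep inE xU in pV.
      have [Eq|_] := eqVneq q x; first by rewrite Eq inE xU in qV.
      by rewrite !andbF andbT.
    - by rewrite disjoint_subset; apply/subsetP => z zU; rewrite !inE zU.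
    move=> p q pU qW; rewrite /del_edge; apply/negP => /andP[epq].
    by have [-> ->] := cross p q pU qW epq; rewrite !eqxx.
  have [leU _] := IH e U (ltc U y UA yA yU) sym irr connU.
  have [|leW _] := IH e (A :\: U) _ sym irr connW.
    by apply: (ltc _ x); rewrite // inE xU.
  have [H1 H2] := bridge_bound sym irr connA UA xU yW exy cross sumA leU leW.
  by split=> // /H2; left.
rewrite negb_exists_in => /forall_inP H.
have crit x y : x \in A -> y \in A -> e x y -> critical e A x y.
  move=> xA yA exy; have := H x xA; rewrite negb_exists_in => /forall_inP/(_ y yA).
  by rewrite exy negbK.
have [connB|[U [UB U0 UneB noU]]] := connVcut e B0.
  (* Connectedness gives an edge at [v]; as it is critical, [A :\ v] keeps the stability number. *)
  have [|||w [y [/set1P-> /setDP[yA _] evy]]] := cA [set v]; rewrite ?sub1set //.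
  - by apply/set0Pn; exists v; rewrite inE.
  - by apply: contraNneq B0 => <-; rewrite setDv.
  have Ea := critical_alpha (crit v y vA yA evy).
  have [|leB eqB] := IH e (A :\ v) _ sym irr connB.
    by rewrite -ltnS (leq_trans _ ltk) // ltnS cardA ltnS.
  rewrite Ea in leB eqB.
  exact: tight_bound sym irr connA vA maxv connB (erefl _) Ea leB eqB.
have BA : A :\ v \subset A by apply: subsetDl.
have nbr (V : {set T}) : V \subset A :\ v -> V != set0 ->
    {in V & (A :\ v) :\: V, forall x y, ~~ e x y} -> exists2 z, z \in V & e v z.
  move=> VB V0 noV; have [|||p [q [pV /setDP[qA qV] epq]]] := cA V.
  - exact: subset_trans BA.
  - exact: V0.
  - apply: contraTneq VB => ->; apply/subsetPn; exists v; rewrite // !inE eqxx.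
    by [].
  have [Eq|nqv] := eqVneq q v; first by exists p; rewrite // -Eq sym.
  by have := noV p q pV; rewrite !inE qV nqv qA epq => /(_ isT).
(* [v] has critical edges to both sides of the cut, which [critical_cut] forbids. *)
have [z zU evz] := nbr U UB U0 noU.
have EW : A :\ v = U :|: ((A :\ v) :\: U) by rewrite -[LHS](setID _ U) (setIidPr UB).
have [||y yW evy] := nbr ((A :\ v) :\: U) (subsetDl _ _).
- by rewrite setD_eq0; apply: contra UneB => BU; rewrite eqEsubset UB.
- move=> p q pW /setDP[qB]; rewrite inE qB andbT negbK => qU.
  by rewrite sym noU.
have dUW : [disjoint U & (A :\ v) :\: U].
  by rewrite disjoint_subset; apply/subsetP => w wU; rewrite !inE wU.
have zA : z \in A by apply: (subsetP BA); apply: (subsetP UB).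
have yA : y \in A by apply: (subsetP BA); move: yW; rewrite inE => /andP[].
have := critical_cut sym irr vA EW dUW noU yW zU (crit v y vA yA evy).
by rewrite crit.
Qed.

End Main.

(** * Concrete graphs *)

Lemma fibonacci_indexE (G : sgraph) : fibonacci_index G = nfib (@adj G) setT.
Proof. by apply: eq_card => S; rewrite !inE subsetT. Qed.

Lemma stability_numberE (G : sgraph) : stability_number G = alpha (@adj G) setT.
Proof. by apply: eq_bigl => S; rewrite subsetT. Qed.

(** A set that no edge leaves is closed under [connect], hence contains all vertices or none. *)
Lemma connectedP (G : sgraph) : connected G -> conn (@adj G) setT.
Proof.
case=> /card_gt0P[x0 _] conG; split=> [|U _ /set0Pn[x xU] UneT].
  by apply/set0Pn; exists x0.
have [y yU] : exists y, y \notin U.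
  by apply/existsP; apply: contraNT UneT; rewrite negb_exists => /forallP H;
    apply/eqP/setP => z; rewrite inE; have := H z; rewrite negbK.
case: (boolP [exists u in U, exists w in setT :\: U, adj u w]) => [|no].
  by case/exists_inP=> u uU /exists_inP[w wU uw]; exists u, w.
have cl u w : u \in U -> adj u w -> w \in U.
  move=> uU uw; apply: contraNT no => wU; apply/exists_inP; exists u => //.
  by apply/exists_inP; exists w; rewrite // !inE wU.
have clU : closed (@adj G) U.
  by move=> u w uw; apply/idP/idP => H; apply: (cl _ _ H); rewrite // adj_sym.
have E : (x \in U) = (y \in U) := closed_connect clU (conG x y).
by move: yU; rewrite -E xU.
Qed.

Lemma isomorphic_fibonacci (G H : sgraph) :
  isomorphic G H -> fibonacci_index G = fibonacci_index H.
Proof.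
case=> f [g fK gK] adjf; rewrite /fibonacci_index.
rewrite -(card_imset _ (imset_inj (can_inj fK))); apply: eq_card => S.
have st (R : {set G}) : stable [set f x | x in R] = stable R.
  apply/indepP/indepP => iR x y => [xR yR|/imsetP[u uR ->] /imsetP[w wR ->]].
    by rewrite -adjf; apply: iR; apply: imset_f.
  by rewrite adjf; apply: iR.
apply/imsetP/idP => [[R + ->]|]; rewrite !inE ?st //.
have ES : [set f x | x in [set g y | y in S]] = S.
  by rewrite -imset_comp (eq_imset _ gK) imset_id.
by move=> iS; exists [set g y | y in S]; rewrite ?inE -?st ES.
Qed.

Lemma isomorphic_ord_graph (G : sgraph) n (r : rel 'I_n) (R : rel nat) (f : G -> nat) :
    #|G| = n -> (forall i j : 'I_n, @adj (ord_graph r) i j = R i j) ->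
    injective f -> (forall x, f x < n) -> (forall x y, adj x y = R (f x) (f y)) ->
  isomorphic G (ord_graph r).
Proof.
move=> cardG adjR f_inj f_lt adjf.
exists (fun x => Ordinal (f_lt x)) => [|x y]; last by rewrite adjR adjf.
by apply: inj_card_bij => [x y [/f_inj] //|]; rewrite card_ord cardG.
Qed.

Lemma adj_turan_connected n a (i j : turan_connected n a) :
  adj i j = tc_adj a (i : 'I_n) (j : 'I_n).
Proof.
rewrite /adj /= /tc_adj -!val_eqE /= [(j : nat) == i]eq_sym.
rewrite [(j : nat) == i %[mod a]]eq_sym !orbb.
by case: (eqVneq (i : nat) j) => //= _; case: (_ == _ %[mod a]).
Qed.

Lemma adj_cycle5 (i j : cycle_graph 5) : adj i j = c5_adj (i : 'I_5) (j : 'I_5).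
Proof. by []. Qed.

Lemma tc_like_isomorphic (G : sgraph) n a : #|G| = n -> tc_like (@adj G) setT a ->
  isomorphic G (turan_connected n a).
Proof.
move=> cardG [f [f_inj f_lt adjf]].
apply: (@isomorphic_ord_graph G n _ (tc_adj a) f cardG).
- exact: adj_turan_connected.
- by move=> x y; apply: f_inj.
- by move=> x; rewrite -cardG -cardsT f_lt.
- by move=> x y; apply: adjf.
Qed.

Lemma c5_like_isomorphic (G : sgraph) : #|G| = 5 -> c5_like (@adj G) setT ->
  isomorphic G (cycle_graph 5).
Proof.
move=> cardG [f [f_inj f_lt adjf]].
apply: (@isomorphic_ord_graph G 5 _ c5_adj f cardG).
- exact: adj_cycle5.
- by move=> x y; apply: f_inj.
- by move=> x; apply: f_lt.
- by move=> x y; apply: adjf.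
Qed.

(** Apply the recursion at the hub 0. Both remaining graphs are unions of cliques colored by
    residues: the first loses 0, the second all of class 0 and the representatives below [a]. *)
Lemma f_TCE n a : 0 < n -> 0 < a <= maxn n.-1 1 -> f_TC n a = tc_num n a.
Proof.
case: n => // m _ /= oka; have /andP[a0 am] := oka.
set G := turan_connected m.+1 a.
have an : a <= m.+1 by clear -am; lia.
rewrite /f_TC fibonacci_indexE.
pose e : rel 'I_m.+1 := @adj G.
have eE i j : e i j = tc_adj a i j by apply: adj_turan_connected.
have sym : symmetric e := @adj_sym G.
have irr : irreflexive e := @adj_irrefl G.
rewrite -/e (nfib_rec (v := ord0) sym irr) ?inE //.
pose c (i : 'I_m.+1) := i %% a.
have colB : cluster_coloring e (setT :\ ord0) a c.
  split=> [i _|i j]; first by rewrite ltn_mod.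
  rewrite !inE !andbT -!val_eqE /= eE /tc_adj => /negPf-> /negPf->.
  by rewrite /= orbF.
have colN : cluster_coloring e (setT :\: nbhd e ord0) a c.
  apply: cluster_coloringS colB; apply: setDS; apply/subsetP => i.
  by rewrite !inE => ->.
rewrite (coloring_nfib sym irr colB) (coloring_nfib sym irr colN).
set q := m %/ a; set r := m %% a.
have ra : r <= a.-1 by rewrite -ltnS prednK // ltn_mod.
have rep k : k < a -> exists i : 'I_m.+1, i = k :> nat.
  by move=> ka; exists (Ordinal (leq_trans ka an)).
have szB0 : #|color_class c (setT :\ ord0) 0| = q.
  apply: succn_inj; rewrite -[RHS]addn1 -[1]/(nat_of_bool (0 <= r)) -card_residue //.
  rewrite [in RHS](cardsD1 ord0) inE mod0n eqxx add1n; congr _.+1.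
  by apply: eq_card => i; rewrite !inE andbT.
have szB k : 0 < k < a -> #|color_class c (setT :\ ord0) k| = q + (k <= r).
  move=> /andP[k0 ka]; rewrite -card_residue //; apply: eq_card => i; rewrite !inE andbT.
  by case: eqVneq => //= ->; rewrite mod0n; case: (k) k0.
have inN (i : 'I_m.+1) : (i \in nbhd e ord0) = (i %% a == 0) || (i < a).
  rewrite inE eE /tc_adj -val_eqE /= mod0n [0 == _ %% a]eq_sym.
  have [->|ni] := eqVneq (i : nat) 0; first by rewrite mod0n.
  by rewrite /= lt0n ni orbF.
have szN0 : #|color_class c (setT :\: nbhd e ord0) 0| = 0.
  apply/eqP; rewrite cards_eq0; apply/eqP/setP => i.
  by rewrite inE in_setD inN in_setT andbT in_set0 /c; case: (i %% a == 0); rewrite ?andbF.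
have szN k : 0 < k < a -> #|color_class c (setT :\: nbhd e ord0) k|.+1 = q + (k <= r).
  move=> /andP[k0 ka]; rewrite -card_residue //; have [i0 Ei0] := rep k ka.
  rewrite [in RHS](cardsD1 i0) inE Ei0 modn_small // eqxx add1n; congr _.+1.
  apply: eq_card => i; rewrite inE in_setD inN in_setT andbT !inE /c -val_eqE /= Ei0.
  case: (eqVneq (i %% a) k) => [Ei|_]; rewrite ?andbF // !andbT negb_or.
  rewrite Ei -lt0n k0 /=; congr negb; apply/idP/eqP => [lt|->//].
  by rewrite -Ei modn_small.
have prodE (F : nat -> nat) : \prod_(i < a) F i = F 0 * \prod_(i < a.-1) F i.+1.
  by rewrite -[in LHS](prednK a0) big_ord_recl.
rewrite (prodE (fun k => #|color_class c (setT :\ ord0) k|.+1)) szB0.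
rewrite (prodE (fun k => #|color_class c (setT :\: nbhd e ord0) k|.+1)) szN0 mul1n.
have lt1 (i : 'I_a.-1) : 0 < i.+1 < a by rewrite /= -[X in _ < X](prednK a0) ltnS.
rewrite (eq_bigr (fun i : 'I_a.-1 => q.+1 + (i < r))) => [|i _]; last by rewrite szB.
rewrite [X in _ + X](eq_bigr (fun i : 'I_a.-1 => q + (i < r))) => [|i _]; last by rewrite szN.
rewrite !prod_step // /tc_num /= spoke_numE // /turan_num -/q -/r.
have -> : a - r = (a.-1 - r).+1 by clear -ra a0; lia.
by rewrite expnS; ring.
Qed.

(** Both sides are 11. Deleting the vertices 0 and 2 in turn splits the cycle count into
    [6 + 2 + 3], each term for a union of cliques. *)
Lemma fibonacci_cycle5 : fibonacci_index (cycle_graph 5) = f_TC 5 2.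
Proof.
rewrite f_TCE // fibonacci_indexE.
pose e : rel 'I_5 := @adj (cycle_graph 5).
have eE i j : e i j = c5_adj i j by apply: adj_cycle5.
have sym : symmetric e := @adj_sym (cycle_graph 5).
have irr : irreflexive e := @adj_irrefl (cycle_graph 5).
have nfibE (s : seq nat) a (c : nat -> nat) : all (fun i => c i < a) s ->
    all (fun i => all (fun j => c5_adj i j == (i != j) && (c i == c j)) s) s ->
    nfib e [set i : 'I_5 | val i \in s] =
    \prod_(k < a) (count (fun i => (i \in s) && (c i == k)) (iota 0 5)).+1.
  move=> /allP c1 /allP c2.
  rewrite (coloring_nfib (c := fun i : 'I_5 => c i) (a := a) sym irr).
    apply: eq_bigr => k _; congr _.+1.
    rewrite -val_enum_ord count_map -size_filter enumT cardE /enum_mem.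
    by congr size; apply: eq_filter => i; rewrite !inE.
  split=> [i|i j]; rewrite !inE; first exact: c1.
  by move=> iS jS; have /allP/(_ _ jS)/eqP := c2 _ iS; rewrite eE.
pose o2 : 'I_5 := Ordinal (isT : 2 < 5).
change (nfib e [set: 'I_5] = tc_num 5 2).
rewrite (nfib_rec (v := ord0) sym irr) ?inE // (nfib_rec (v := o2) sym irr) ?inE //.
have -> : [set: 'I_5] :\ ord0 :\ o2 = [set i | val i \in [:: 1; 3; 4]].
  by apply/setP => -[[|[|[|[|[|k]]]]] ?]; rewrite !inE.
have -> : ([set: 'I_5] :\ ord0) :\: nbhd e o2 = [set i | val i \in [:: 4]].
  by apply/setP => -[[|[|[|[|[|k]]]]] ?]; rewrite !inE ?eE.
have -> : [set: 'I_5] :\: nbhd e ord0 = [set i | val i \in [:: 2; 3]].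
  by apply/setP => -[[|[|[|[|[|k]]]]] ?]; rewrite !inE ?eE.
rewrite (nfibE _ 2 (fun i => i %/ 3)) // (nfibE _ 1 (fun=> 0)) // (nfibE _ 1 (fun=> 0)) //.
by rewrite !big_ord_recl !big_ord0.
Qed.

Theorem theorem3 (G : sgraph) (n alpha : nat)
    (G_connected : connected G)
    (G_order : #|G| = n)
    (G_stability : stability_number G = alpha) :
  (2 <= n -> 1 <= alpha <= n.-1) /\
  fibonacci_index G <= f_TC n alpha /\
  ((n, alpha) <> (5, 2) ->
     (fibonacci_index G = f_TC n alpha <->
      isomorphic G (turan_connected n alpha))) /\
  ((n, alpha) = (5, 2) ->
     (fibonacci_index G = f_TC n alpha <->
      isomorphic G (turan_connected 5 2) \/ isomorphic G (cycle_graph 5))).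
Proof.
have sym := @adj_sym G; have irr := @adj_irrefl G.
have conG := connectedP G_connected.
have n0 : 0 < n by rewrite -G_order; case: G_connected.
have oka := conn_alpha irr conG.
have [le eq] := conn_bound sym irr conG.
rewrite -stability_numberE G_stability cardsT G_order in oka le eq.
rewrite -fibonacci_indexE -f_TCE // in le eq.
have isoF H : isomorphic G H -> fibonacci_index H = f_TC n alpha ->
    fibonacci_index G = f_TC n alpha.
  by move=> /isomorphic_fibonacci->.
split.
  by case: n {G_order le eq isoF} n0 oka => // -[|m] _ //= /andP[-> +] _; rewrite (maxn_idPl _).
split=> //; split=> [ne|E]; split.
- case/eq => [/(tc_like_isomorphic G_order) //|[En Ea _]].
  by case: ne; rewrite -G_order -cardsT En Ea.
- by move=> iso; apply: (isoF _ iso).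
- case: E => En Ea; case/eq => [/(tc_like_isomorphic G_order)|[_ _ c5]].
    by rewrite En Ea; left.
  by right; apply: c5_like_isomorphic; rewrite ?G_order.
case: E => En Ea; case=> iso; apply: (isoF _ iso); rewrite En Ea //.
exact: fibonacci_cycle5.
Qed.
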